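(* Let $\mathcal H_1,\mathcal H_2$ be Hilbert spaces, $A$ a self-adjoint operator in $\mathcal H_1$ bounded from below, $B$ a densely defined closable operator from $\mathcal H_2$ to $\mathcal H_1$, and $D$ a self-adjoint operator in $\mathcal H_2$ bounded from above; let $\mathfrak a$, $\mathfrak d$ be the closed quadratic forms associated with $A$, $D$. Assume that $\mathrm{dom}(\mathfrak a)\subset\mathrm{dom}(B^* )$ and that either (I) $\mathrm{dom}(B)\subset\mathrm{dom}(D)$ and $\mathrm{dom}(B)$ is a core for $D$, or (II) $\mathrm{dom}(\mathfrak d)\subset\mathrm{dom}(B)$. Let $\mathcal M$ be the closure of $\mathcal M_0=\begin{pmatrix}A&B\\-B^*&D\end{pmatrix}$ with $\mathrm{dom}(\mathcal M_0)=(\mathrm{dom}(A)\cap\mathrm{dom}(B^* ))\times(\mathrm{dom}(B)\cap\mathrm{dom}(D))$ in $\mathcal H_1\oplus\mathcal H_2$. Let $a\in\mathbb R$, $b\ge0$ be such that $\|B^*x\|^2\le a\|x\|^2+b\,\mathfrak a[x]$ for all $x\in\mathrm{dom}(\mathfrak a)$, let $\alpha_-=\min\sigma(A)$, $\delta_+=\max\sigma(D)$, and let $\mu,\mu_+$ be as defined in the context. Assume that $$b\delta_++b^2+a<0\qquad\text{or}\qquad\frac{\alpha_--\delta_+}{2}>b+\sqrt{(b\delta_++b^2+a)_+}.$$ Then for every $\gamma\in(\mu,\mu_+)$ the operator $\mathcal M-\gamma$ is non-negative in the Krein space $\mathcal K=\mathcal H_1\oplus\mathcal H_2$ with inner product $[\cdot,\cdot]$,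 i.e. $[(\mathcal M-\gamma)w,w]\ge0$ for all $w\in\mathrm{dom}(\mathcal M)$, and $\gamma\in\rho(\mathcal M)$.
   Context: Hilbert spaces are non-zero and complex. $\mathfrak a$ has domain $\mathrm{dom}(|A|^{1/2})$ and $\mathfrak a[x]=\mathfrak a[x,x]$; $\mathfrak d$ has domain $\mathrm{dom}(|D|^{1/2})$. Under the stated assumptions $\mathcal M_0$ is closable and such $a,b$ exist (with $a+b\alpha_-\ge0$). Write $(t)_+=\max\{t,0\}$. The Krein space inner product is $\bigl[\binom{x}{y},\binom{\hat x}{\hat y}\bigr]=\langle x,\hat x\rangle-\langle y,\hat y\rangle$. Set $\mu=\delta_++b+\sqrt{(b\delta_++b^2+a)_+}$. Consider (A1) $b\delta_++b^2+a\le0$ and $b>0$; (A2) $\frac{\alpha_--\delta_+}2\ge b+\sqrt{(b\delta_++b^2+a)_+}$. Set $$\mu_+=\begin{cases}-\frac ab&\text{if (A1) holds but (A2) does not},\\ \alpha_--b-\sqrt{(b\delta_++b^2+a)_+}&\text{if (A2) holds but (A1) does not},\\ \max\{-\frac ab,\alpha_--b\}&\text{if (A1) and (A2) hold}.\end{cases}$$ *)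

(* Defs.v *)
From HB Require Import structures.
From mathcomp Require Export all_boot all_order all_algebra.
From mathcomp Require Export all_classical all_reals all_analysis.
From mathcomp Require Export complex.
Export Order.TTheory GRing.Theory Num.Theory numFieldNormedType.Exports.

Set Implicit Arguments.
Unset Strict Implicit.
Unset Printing Implicit Defensive.

Local Open Scope ring_scope.
Local Open Scope classical_set_scope.
Local Open Scope complex_scope.

(* Complex Hilbert spaces over R[i]. The norm of a normed R[i]-module takes its
   values in R[i], whose order is z <= w iff Im z = Im w and Re z <= Re w; an
   inequality in R[i] thus also says that both sides have equal imaginary
   parts. The inner product is linear in its first argument. *)
HB.mixin Record CompleteNormedModule_isHilbert (R : realType) (H : Type)
    & CompleteNormedModule R[i] H := {
  inner : {dot H for (@Num.conj R[i])};
  inner_norm : forall x : H, `|x| ^+ 2 = inner x x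
}.

#[short(type="hilbertType")]
HB.structure Definition Hilbert (R : realType) :=
  {H of CompleteNormedModule_isHilbert R H & CompleteNormedModule R[i] H}.

(* Unbounded operators from V to W are represented by their graphs, which are
   subsets of V * W. Adjoint, closure, and resolvent set are then total
   operations; the closure of a graph is [closure] in the product topology. *)

Definition dom (R : realType) (V W : normedModType R[i]) (T : set (V * W))
  : set V := [set x | exists y, T (x, y)].

Definition single_valued (R : realType) (V W : normedModType R[i])
    (T : set (V * W)) : Prop :=
  forall x y y', T (x, y) -> T (x, y') -> y = y'.

Definition is_operator (R : realType) (V W : normedModType R[i])
    (T : set (V * W)) : Prop :=
  [/\ T (0, 0),
      (forall (c : R[i]) x y x' y', T (x, y) -> T (x', y') ->
         T (c *: x + x', c *: y + y'))
    & single_valued T].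

Definition densely_defined (R : realType) (V W : normedModType R[i])
    (T : set (V * W)) : Prop := dense (dom T).

Definition closable (R : realType) (V W : normedModType R[i])
    (T : set (V * W)) : Prop := single_valued (closure T).

Definition op_restrict (R : realType) (V W : normedModType R[i])
    (T : set (V * W)) (S : set V) : set (V * W) :=
  [set p | T p /\ S p.1].

Definition is_core (R : realType) (V W : normedModType R[i])
    (T : set (V * W)) (S : set V) : Prop :=
  S `<=` dom T /\ closure (op_restrict T S) = closure T.

(* The graph of S \o T. *)
Definition op_comp (R : realType) (U V W : normedModType R[i])
    (S : set (V * W)) (T : set (U * V)) : set (U * W) :=
  [set p | exists2 z, T (p.1, z) & S (z, p.2)].

(* The graph of T - z. *)
Definition op_shift (R : realType) (V : normedModType R[i])
    (T : set (V * V)) (z : R[i]) : set (V * V) :=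
  [set p | T (p.1, p.2 + z *: p.1)].

(* T - z has an everywhere defined bounded inverse. *)
Definition resolvent_set (R : realType) (V : normedModType R[i])
    (T : set (V * V)) : set R[i] :=
  [set z | (forall v, exists! u, op_shift T z (u, v)) /\
     exists c : R, forall u v, op_shift T z (u, v) -> `|u| <= c%:C * `|v|].

Definition spectrum (R : realType) (V : normedModType R[i])
    (T : set (V * V)) : set R[i] := ~` resolvent_set T.

Definition is_min_spectrum (R : realType) (V : normedModType R[i])
    (T : set (V * V)) (m : R) : Prop :=
  spectrum T m%:C /\ forall z, spectrum T z -> m%:C <= z.

Definition is_max_spectrum (R : realType) (V : normedModType R[i])
    (T : set (V * V)) (m : R) : Prop :=
  spectrum T m%:C /\ forall z, spectrum T z -> z <= m%:C.

Definition adjoint (R : realType) (H K : hilbertType R)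
    (T : set (H * K)) : set (K * H) :=
  [set p | forall x y, T (x, y) -> inner y p.1 = inner x p.2].

Definition self_adjoint (R : realType) (H : hilbertType R)
    (T : set (H * H)) : Prop :=
  [/\ is_operator T, densely_defined T & adjoint T = T].

Definition bounded_from_below (R : realType) (H : hilbertType R)
    (T : set (H * H)) : Prop :=
  exists c : R, forall x y, T (x, y) -> c%:C * `|x| ^+ 2 <= inner y x.

Definition bounded_from_above (R : realType) (H : hilbertType R)
    (T : set (H * H)) : Prop :=
  exists c : R, forall x y, T (x, y) -> inner y x <= c%:C * `|x| ^+ 2.

Definition nonnegative (R : realType) (H : hilbertType R)
    (T : set (H * H)) : Prop :=
  forall x y, T (x, y) -> 0 <= inner y x.

(* S is the non-negative self-adjoint square root of T. *)
Definition is_op_sqrt (R : realType) (H : hilbertType R)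
    (T S : set (H * H)) : Prop :=
  [/\ self_adjoint S, nonnegative S & op_comp S S = T].

(* S = |T|^{1/2}, where |T| = (T^* T)^{1/2}. *)
Definition is_sqrt_abs (R : realType) (H : hilbertType R)
    (T S : set (H * H)) : Prop :=
  exists2 P : set (H * H),
    is_op_sqrt (op_comp (adjoint T) T) P & is_op_sqrt P S.

(* A form with domain [form_dom]; the values of [form_val] outside the domain
   are irrelevant. *)
Record qform (R : realType) (H : hilbertType R) := QForm {
  form_dom : set H;
  form_val :> H -> H -> R[i]
}.

Definition is_symmetric_qform (R : realType) (H : hilbertType R)
    (q : qform H) : Prop :=
  [/\ form_dom q 0,
      (forall (c : R[i]) x y, form_dom q x -> form_dom q y ->
         form_dom q (c *: x + y)),
      (forall (c : R[i]) x y z, form_dom q x -> form_dom q y ->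
         form_dom q z -> q (c *: x + y) z = c * q x z + q y z)
    & (forall x y, form_dom q x -> form_dom q y ->
         q y x = Num.conj (q x y))].

Definition semibounded_qform (R : realType) (H : hilbertType R)
    (q : qform H) : Prop :=
  exists c : R,
    (forall x, form_dom q x -> c%:C * `|x| ^+ 2 <= q x x) \/
    (forall x, form_dom q x -> q x x <= c%:C * `|x| ^+ 2).

Definition closed_qform (R : realType) (H : hilbertType R)
    (q : qform H) : Prop :=
  forall (u : nat -> H) (l : H),
    (forall n, form_dom q (u n)) ->
    u @ \oo --> l ->
    (forall e : R, 0 < e -> exists N, forall m n, (N <= m)%N -> (N <= n)%N ->
       `|q (u m - u n) (u m - u n)| < e%:C) ->
    form_dom q l /\
    (forall e : R, 0 < e -> exists N, forall n, (N <= n)%N ->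
       `|q (u n - l) (u n - l)| < e%:C).

(* q is the closed form associated with the semibounded self-adjoint operator
   T: its domain is dom(|T|^{1/2}), and T is the operator that q represents in
   the sense of the first representation theorem, which determines q. *)
Definition is_form_of (R : realType) (H : hilbertType R)
    (T : set (H * H)) (q : qform H) : Prop :=
  [/\ is_symmetric_qform q, semibounded_qform q, closed_qform q,
      (exists2 S, is_sqrt_abs T S & form_dom q = dom S)
    & (forall x y, T (x, y) <->
         form_dom q x /\ forall z, form_dom q z -> q x z = inner y z)].

(* The product norm on H1 * H2 is the maximum norm, which is equivalent to the
   Hilbert norm of the orthogonal sum; closures and resolvent sets agree. *)
Definition block_op (R : realType) (H1 H2 : hilbertType R)
    (A : set (H1 * H1)) (B : set (H2 * H1)) (D : set (H2 * H2))
  : set ((H1 * H2) * (H1 * H2)) :=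
  [set p | exists Ax Bsx By Dy,
     [/\ A (p.1.1, Ax), adjoint B (p.1.1, Bsx), B (p.1.2, By), D (p.1.2, Dy)
       & p.2 = (Ax + By, - Bsx + Dy)]].

Definition krein_inner (R : realType) (H1 H2 : hilbertType R)
    (w w' : H1 * H2) : R[i] := inner w.1 w'.1 - inner w.2 w'.2.

Definition krein_nonnegative (R : realType) (H1 H2 : hilbertType R)
    (T : set ((H1 * H2) * (H1 * H2))) : Prop :=
  forall w v, T (w, v) -> 0 <= krein_inner v w.

Definition pos_part (R : realType) (t : R) : R := Num.max t 0.

Definition mu (R : realType) (a b delta : R) : R :=
  delta + b + Num.sqrt (pos_part (b * delta + b ^+ 2 + a)).

Definition condA1 (R : realType) (a b delta : R) : bool :=
  (b * delta + b ^+ 2 + a <= 0) && (0 < b).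

Definition condA2 (R : realType) (a b alpha delta : R) : bool :=
  b + Num.sqrt (pos_part (b * delta + b ^+ 2 + a)) <= (alpha - delta) / 2.

(* The value when neither condition holds is arbitrary; that case is excluded
   by the hypotheses of the theorem (if b = 0, then a >= 0). *)
Definition mu_plus (R : realType) (a b alpha delta : R) : R :=
  if condA1 a b delta && ~~ condA2 a b alpha delta then - a / b
  else if condA2 a b alpha delta && ~~ condA1 a b delta then
    alpha - b - Num.sqrt (pos_part (b * delta + b ^+ 2 + a))
  else Num.max (- a / b) (alpha - b).

(* Main.v *)
(* The lower bound [qa x x >= lam * |x|^2] (with [lam] either [alpha] or [- a / b])
   and the bound on [B^*] make the Schur complement
   [s x z = qa x z - g <x,z> + <(D - g)^-1 B^* x, B^* z>] a closed form bounded
   below by a positive constant for every [g] between [mu] and [mu_plus]. The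
   same inequality shows [J (M0 - g) >= e > 0], which gives Krein
   non-negativity, injectivity and the resolvent bound, and all three pass to
   the closure. For surjectivity, the Riesz theorem for [s] produces [x] in the
   form domain and [y = (D - g)^-1 (h + B^* x)] solving the equation weakly; such
   a weak solution lies in the closure of [M0], because [y] can be approximated
   in the graph norm of [D] by elements of [dom B]. *)

From mathcomp Require Import ring lra.
Require Import Defs.

Set Implicit Arguments.
Unset Strict Implicit.
Unset Printing Implicit Defensive.

Local Open Scope ring_scope.
Local Open Scope classical_set_scope.
Local Open Scope complex_scope.

(** * Real parts of norms and inner products *)

Local Notation Re := complex.Re.
Local Notation Im := complex.Im.

(** All estimates are made in [R], on real parts: the order of [R[i]] is partial, while infima,
    suprema and discriminants need a total one. Nothing is lost, because [inner x y] is recovered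
    from [rip x y] and [rip ('i%C *: x) y], so imaginary parts reduce to real ones. No spectral
    theorem enters. The spectrum acts only through the existence of resolvents, from which the
    bounds of the forms of [A] and [D] are derived. The two values of [lam] are the two lower bounds
    at hand for [qa]: the spectral one, and for [b > 0] the one hidden in 0 <= |B^* x|^2 <= a |x|^2
    + b qa[x]. The obstacle to surjectivity is that the Riesz solution [x] lies only in the form
    domain, so that A x and B y need not exist separately. The resolvent of [A] at [alpha - 1]
    replaces [x] by nearby elements of [dom A]. *)

Definition nrm {R : realType} {V : normedModType R[i]} (x : V) : R := Re `|x|.

Section RealNorm.
Context {R : realType} {V : normedModType R[i]}.

Lemma normE (x : V) : `|x| = (nrm x)%:C.
Proof. by rewrite /nrm RRe_real // normr_real. Qed.

Lemma nrm_ge0 (x : V) : 0 <= nrm x.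
Proof. by rewrite -lecR -normE normr_ge0. Qed.

Lemma nrm0 : nrm (0 : V) = 0.
Proof. by rewrite /nrm normr0. Qed.

Lemma nrm_eq0 (x : V) : nrm x = 0 -> x = 0.
Proof. by move=> x0; apply/eqP; rewrite -normr_eq0 normE x0. Qed.

Lemma nrmN (x : V) : nrm (- x) = nrm x.
Proof. by rewrite /nrm normrN. Qed.

Lemma nrm_distC (x y : V) : nrm (x - y) = nrm (y - x).
Proof. by rewrite /nrm distrC. Qed.

Lemma nrmD (x y : V) : nrm (x + y) <= nrm x + nrm y.
Proof. by rewrite -lecR rmorphD /= -!normE ler_normD. Qed.

Lemma nrmB (x y : V) : nrm (x - y) <= nrm x + nrm y.
Proof. by rewrite -(nrmN y) nrmD. Qed.

Lemma nrm_triangle (z x y : V) : nrm (x - y) <= nrm (x - z) + nrm (z - y).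
Proof. by rewrite -(subrKA z) nrmD. Qed.

Lemma nrmZ (r : R) (x : V) : nrm (r%:C *: x) = `|r| * nrm x.
Proof.
apply: complexI; rewrite rmorphM /= -!normE normrZ; congr (_ * _).
by rewrite normc_def /= expr0n /= addr0 sqrtr_sqr.
Qed.

Lemma normZi (x : V) : nrm ('i%C *: x) = nrm x.
Proof.
apply: complexI; rewrite -!normE normrZ normc_def /= expr0n expr1n /= add0r.
by rewrite sqrtr1 mul1r.
Qed.

Lemma dense_nrm (S : set V) (x : V) (e : R) : dense S -> 0 < e ->
  exists y, S y /\ nrm (x - y) < e.
Proof.
move=> dS e0.
have e0C : 0 < e%:C by rewrite ltcR.
have [|y [xy Sy]] := dS (ball x e%:C) _ (ball_open x e%:C).
  by exists x; apply: ballxx.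
exists y; split=> //.
by move: xy; rewrite -ball_normE /= normE ltcR.
Qed.

Lemma cvg_nrm (u : nat -> V) (l : V) :
  (forall e : R, 0 < e -> exists N, forall n, (N <= n)%N -> nrm (u n - l) < e) ->
  u @ \oo --> l.
Proof.
move=> ul; apply/cvgrPdist_lt => e e0.
have e0R : 0 < Re e by move: e0; rewrite ltcE => /andP[].
have eE : e = (Re e)%:C by rewrite RRe_real // gtr0_real.
have [N ulN] := ul _ e0R.
exists N => // n /= Nn; rewrite eE normE ltcR nrm_distC; exact: ulN.
Qed.

End RealNorm.

Lemma closure_nrmP (R : realType) (V W : normedModType R[i]) (S : set (V * W)) (p : V * W) :
  closure S p <-> forall e : R, 0 < e ->
    exists x y, [/\ S (x, y), nrm (p.1 - x) < e & nrm (p.2 - y) < e].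
Proof.
split=> [Sp e e0|Sp B /nbhs_ballP[e /= e0 eB]].
  have e0C : 0 < e%:C by rewrite ltcR.
  have /Sp[[x y] [Sxy]] := nbhsx_ballx p _ e0C.
  rewrite -ball_normE /= => pxy; exists x, y.
  move: pxy; rewrite prod_normE /= => pxy.
  rewrite comparable_gt_max in pxy; last first.
    by apply: real_comparable; apply: normr_real.
  by case/andP: pxy; rewrite normE ltcR => h1; rewrite normE ltcR => h2; split.
have e0R : 0 < Re e by move: e0; rewrite ltcE => /andP[].
have eE : e = (Re e)%:C by rewrite RRe_real // gtr0_real.
have [x [y [Sxy px py]]] := Sp _ e0R.
exists (x, y); split=> //; apply: eB; rewrite -ball_normE /= prod_normE /=.
rewrite eE comparable_gt_max; last by apply: real_comparable; apply: normr_real.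
by rewrite !normE !ltcR px py.
Qed.

Lemma cauchy_nrm_cvg (R : realType) (V : completeNormedModType R[i])
    (u : nat -> V) :
  (forall e : R, 0 < e -> exists N, forall m n, (N <= m)%N -> (N <= n)%N ->
     nrm (u m - u n) < e) ->
  exists l : V, u @ \oo --> l.
Proof.
move=> cu; suff cF : cauchy (u n @[n --> \oo]).
  by exists (lim (u n @[n --> \oo])); apply/(@cauchy_cvgP V).
apply: cauchy_exP => e e0.
have e0R : 0 < Re e by move: e0; rewrite ltcE => /andP[].
have eE : e = (Re e)%:C by rewrite RRe_real // gtr0_real.
have [N cuN] := cu _ e0R.
exists (u N); exists N => // n /= Nn.
by rewrite -ball_normE /= eE normE ltcR; apply: cuN.
Qed.

Lemma cvg_nrmP (R : realType) (V : normedModType R[i]) (u : nat -> V) (l : V) :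
  u @ \oo --> l <->
  (forall e : R, 0 < e -> exists N, forall n, (N <= n)%N -> nrm (u n - l) < e).
Proof.
split=> [ul e e0|]; last exact: cvg_nrm.
have e0C : 0 < e%:C by rewrite ltcR.
have /cvgrPdist_lt/(_ _ e0C)[N _ ulN] := ul.
by exists N => n /ulN /=; rewrite normE ltcR nrm_distC.
Qed.

Section RealInner.
Context {R : realType} {H : hilbertType R}.
Implicit Types (x y z : H) (r : R).

Definition rip {H : hilbertType R} (x y : H) : R := Re (inner x y).

Lemma innerC x y : inner y x = (inner x y)^*%C.
Proof. by rewrite hermC /= mul1r. Qed.

Lemma ripC x y : rip x y = rip y x.
Proof. by rewrite /rip innerC; case: (inner _ _). Qed.

Lemma ripDl x y z : rip (x + y) z = rip x z + rip y z.
Proof. by rewrite /rip linearDl /= raddfD. Qed.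

Lemma ripNl x z : rip (- x) z = - rip x z.
Proof. by rewrite /rip linearNl /= raddfN. Qed.

Lemma ripBl x y z : rip (x - y) z = rip x z - rip y z.
Proof. by rewrite ripDl ripNl. Qed.

Lemma ripZl r x z : rip (r%:C *: x) z = r * rip x z.
Proof. by rewrite /rip linearZl_LR /=; case: (inner _ _) => p q /=; rewrite mul0r subr0. Qed.

Lemma ripDr x y z : rip z (x + y) = rip z x + rip z y.
Proof. by rewrite ripC ripDl !(ripC z). Qed.

Lemma ripNr x z : rip z (- x) = - rip z x.
Proof. by rewrite ripC ripNl ripC. Qed.

Lemma ripBr x y z : rip z (x - y) = rip z x - rip z y.
Proof. by rewrite ripDr ripNr. Qed.

Lemma ripZr r x z : rip z (r%:C *: x) = r * rip z x.
Proof. by rewrite ripC ripZl ripC. Qed.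

Lemma rip0l x : rip 0 x = 0.
Proof. by rewrite -(subrr (0 : H)) ripBl subrr. Qed.

Lemma Im_inner x y : Im (inner x y) = - rip ('i%C *: x) y.
Proof.
rewrite /rip linearZl_LR /=; case: (inner _ _) => p q /=.
by rewrite mul0r mul1r sub0r opprK.
Qed.

Lemma innerE x y : inner x y = rip x y +i* - rip ('i%C *: x) y.
Proof. by rewrite -Im_inner /rip; case: (inner _ _). Qed.

Lemma nrm_sqr x : nrm x ^+ 2 = rip x x.
Proof.
by apply: complexI; rewrite rmorphXn /= -normE inner_norm /rip RRe_real ?ger0_real.
Qed.

Lemma rip_ge0 x : 0 <= rip x x.
Proof. by rewrite -nrm_sqr sqr_ge0. Qed.

Lemma inner_xx x : inner x x = (nrm x ^+ 2)%:C.
Proof. by rewrite rmorphXn /= -normE inner_norm. Qed.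

(** For [s > 0] the minimiser [- q / s] decides. The case [s = 0] is kept because some forms below
    are only semidefinite; there a nonzero [q] would let the affine function of [t] reach -1. *)
Lemma quad_discr (p q s : R) : 0 <= s ->
  (forall t, 0 <= p + 2 * t * q + t ^+ 2 * s) -> q ^+ 2 <= p * s.
Proof.
move=> s0 pqs; have [sp|sn] := ltP 0 s.
  have := pqs (- q / s).
  have -> : p + 2 * (- q / s) * q + (- q / s) ^+ 2 * s = (p * s - q ^+ 2) / s.
    by field; rewrite gt_eqF.
  by rewrite pmulr_lge0 ?invr_gt0 // subr_ge0.
have {s0 sn} s0 : s = 0 by apply/eqP; rewrite eq_le s0 sn.
have [->|q0] := eqVneq q 0; first by rewrite s0 expr0n mulr0.
have := pqs (- (p + 1) / (2 * q)).
have -> : p + 2 * (- (p + 1) / (2 * q)) * q = -1 by field.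
by rewrite s0 mulr0 addr0 lerNr oppr0 ler10.
Qed.

Lemma rip_CS x y : rip x y ^+ 2 <= nrm x ^+ 2 * nrm y ^+ 2.
Proof.
rewrite !nrm_sqr; apply: quad_discr => [|t]; first exact: rip_ge0.
have := rip_ge0 (x + t%:C *: y).
rewrite ripDl !ripDr !ripZl !ripZr (ripC y x); lra.
Qed.

Lemma ler_rip x y : `|rip x y| <= nrm x * nrm y.
Proof.
rewrite -(@ler_pXn2r _ 2) ?nnegrE ?mulr_ge0 ?nrm_ge0 //.
by rewrite real_normK ?num_real // exprMn rip_CS.
Qed.

Lemma dense_rip_eq0 (S : set H) (w : H) : dense S ->
  (forall y, S y -> rip y w = 0) -> w = 0.
Proof.
move=> dS Sw; apply: nrm_eq0; apply/eqP; apply: contraT => w0.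
have {}w0 : 0 < nrm w by rewrite lt_def w0 nrm_ge0.
have [y [Sy wy]] := dense_nrm w dS w0.
have := ler_rip (w - y) w; rewrite ripBl (Sw _ Sy) subr0 -nrm_sqr.
have := ler_norm (nrm w ^+ 2); nra.
Qed.

End RealInner.

(** * Real forms *)

Section RealForms.
Context {R : realType} {H : hilbertType R}.
Implicit Types (F : set H) (q : H -> H -> R) (x y z : H).

Definition real_form F q : Prop :=
  [/\ F 0,
      (forall (r : R) x y, F x -> F y -> F (r%:C *: x + y)),
      (forall (r : R) x y z, F x -> F y -> F z ->
         q (r%:C *: x + y) z = r * q x z + q y z)
    & (forall x y, F x -> F y -> q x y = q y x)].

(** Completeness for the distance given by [q] itself: for a coercive [q] it makes [F] a real
    Hilbert space, as the Riesz argument needs. *)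
Definition form_complete F q : Prop :=
  forall u : nat -> H, (forall n, F (u n)) ->
    (forall e : R, 0 < e -> exists N, forall m n, (N <= m)%N -> (N <= n)%N ->
       q (u m - u n) (u m - u n) < e) ->
    exists2 l, F l &
      forall e : R, 0 < e -> exists N, forall n, (N <= n)%N ->
        q (u n - l) (u n - l) < e.

Lemma subE (x y : H) : x - y = (-1)%:C *: y + x.
Proof. by rewrite rmorphN1 scaleN1r addrC. Qed.

Lemma real_form_subr F q x y : real_form F q -> F x -> F y -> F (x - y).
Proof. by case=> _ FD _ _ Fx Fy; rewrite subE; apply: FD. Qed.

Lemma real_formB F q x y z : real_form F q -> F x -> F y -> F z ->
  q (x - y) z = q x z - q y z.
Proof. by case=> _ _ ql _ Fx Fy Fz; rewrite subE ql // mulN1r addrC. Qed.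

Lemma real_form_line F q x z (t : R) : real_form F q -> F x -> F z ->
  q (t%:C *: z + x) (t%:C *: z + x) = q x x + 2 * t * q x z + t ^+ 2 * q z z.
Proof.
case=> _ FD ql qs Fx Fz; have Fw := FD t _ _ Fz Fx.
rewrite ql // (qs z) // (qs x (_ + _)) // !ql // (qs z x) //; ring.
Qed.

Lemma real_form_CS F q x y : real_form F q -> (forall z, F z -> 0 <= q z z) ->
  F x -> F y -> q x y ^+ 2 <= q x x * q y y.
Proof.
move=> qf q0 Fx Fy; apply: quad_discr => [|t]; first exact: q0.
by rewrite -(real_form_line _ qf) //; apply: q0; case: qf => _ FD _ _; apply: FD.
Qed.

Lemma real_form_add F q1 q2 : real_form F q1 -> real_form F q2 ->
  real_form F (fun x y => q1 x y + q2 x y).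
Proof.
case=> F0 FD l1 s1 [_ _ l2 s2]; split=> // [r x y z Fx Fy Fz|x y Fx Fy].
  by rewrite l1 // l2 //; ring.
by rewrite s1 // s2.
Qed.

Lemma real_form_rip F q (c : R) : real_form F q ->
  real_form F (fun x y => c * rip x y).
Proof.
case=> F0 FD _ _; split=> // [r x y z Fx Fy Fz|x y Fx Fy].
  by rewrite ripDl ripZl; ring.
by rewrite ripC.
Qed.

Lemma le0_small (p k : R) : (forall e, 0 < e -> p <= e * k) -> p <= 0.
Proof.
move=> pe; apply/ler_addgt0Pr => e e0; rewrite add0r.
have k0 : 0 < `|k| + 1 by rewrite ltr_wpDl.
apply: le_trans (pe (e / (`|k| + 1)) _) _; first exact: divr_gt0.
rewrite -mulrA ler_piMr ?(ltW e0) // mulrC ler_pdivrMr // mul1r.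
by apply: le_trans (ler_norm k) _; rewrite lerDl.
Qed.

Lemma inv_succ_small (e : R) : 0 < e ->
  exists N, forall n, (N <= n)%N -> n.+1%:R^-1 < e.
Proof.
move=> e0; exists (Num.bound e^-1) => n Nn.
rewrite invf_plt ?posrE //; apply: lt_le_trans (archi_boundP _) _.
  by rewrite invr_ge0 ltW.
by rewrite ler_nat leqW.
Qed.

(* Minimise [q z z - 2 * l z]: minimising sequences are Cauchy for [q] by the
   parallelogram identity, and their limit solves the Euler equation. *)
Lemma real_form_riesz F q (l : H -> R) (K : R) :
  real_form F q -> (forall z, F z -> 0 <= q z z) -> form_complete F q ->
  (forall (r : R) x y, F x -> F y -> l (r%:C *: x + y) = r * l x + l y) ->
  (forall x, F x -> l x ^+ 2 <= K * q x x) -> 0 <= K ->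
  exists2 x, F x & forall z, F z -> q x z = l z.
Proof.
move=> qf q0 qc ll lK K0; have [F0 FD ql qs] := qf.
pose J z := q z z - 2 * l z.
have J_line x z t : F x -> F z ->
    J (t%:C *: z + x) = J x + 2 * t * (q x z - l z) + t ^+ 2 * q z z.
  by move=> Fx Fz; rewrite /J (real_form_line _ qf) // ll //; ring.
have J_lb z : F z -> - K <= J z.
  move=> Fz; have := lK _ Fz; have := q0 _ Fz; rewrite /J => h1 h2.
  rewrite leNgt; apply/negP => h3; have h4 : q z z + K < 2 * l z by lra.
  have h5 : (q z z + K) * (q z z + K) < 2 * l z * (2 * l z) by apply: ltr_pM => //; lra.
  have := sqr_ge0 (q z z - K); lra.
pose E := [set J z | z in F]; pose I := inf E.
have Einf : has_inf E.
  split; first by exists (J 0), 0.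
  by exists (- K) => _ [z Fz <-]; apply: J_lb.
have I_le z : F z -> I <= J z.
  by move=> Fz; apply: ge_inf; [case: Einf | exists z].
have /choice[u uP] : forall n, exists z, F z /\ J z < I + n.+1%:R^-1.
  move=> n; have [|_ [z Fz <-] zI] := @inf_adherent _ E n.+1%:R^-1 _ Einf.
    by rewrite invr_gt0.
  by exists z.
have Fu n : F (u n) by case: (uP n).
have uc m n : q (u m - u n) (u m - u n) <= 2 * (m.+1%:R^-1 + n.+1%:R^-1).
  have [Fm Jm] := uP m; have [Fn Jn] := uP n.
  have Fd := real_form_subr qf Fm Fn; set d := u m - u n in Fd *.
  have umE : u m = 1%:C *: d + u n by rewrite scale1r subrK.
  have := J_line (u n) d 1 Fn Fd; rewrite -umE => h1.
  have := J_line (u n) d 2^-1 Fn Fd => h2.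
  have := I_le _ (FD 2^-1 _ _ Fd Fn); rewrite h2 => h3.
  move: Jm Jn h1 h3; rewrite expr1n !mulr1 mul1r divff ?pnatr_eq0 // mul1r.
  rewrite (_ : 2^-1 ^+ 2 = 4^-1); last by rewrite exprVn -natrX.
  by move: m.+1%:R^-1 n.+1%:R^-1 => em en; lra.
have [e e0|x Fx ux] := qc u Fu.
  have e4 : 0 < e / 4 by lra.
  have [N NP] := inv_succ_small e4.
  exists N => m n /NP hm /NP hn; apply: le_lt_trans (uc m n) _.
  by move: m.+1%:R^-1 n.+1%:R^-1 hm hn => em en; lra.
exists x => // z Fz; apply/eqP; rewrite -subr_eq0 -sqrf_eq0 eq_le sqr_ge0 andbT.
apply: (@le0_small _ (4 * q z z)) => e e0.
have [N1 N1P] := inv_succ_small e0; have [N2 N2P] := ux _ e0.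
pose n := maxn N1 N2.
have h1 := N1P n (leq_maxl _ _); have h2 := N2P n (leq_maxr _ _).
have Fxn := real_form_subr qf (Fu n) Fx.
have h3 := real_form_CS qf q0 Fxn Fz.
rewrite (real_formB qf) // in h3.
(* Since J(u_n + t z) >= I > J(u_n) - 1/(n+1) for every [t], the discriminant test bounds the Euler
   residual at [u n]. *)
have h4 : (q (u n) z - l z) ^+ 2 <= n.+1%:R^-1 * q z z.
  apply: quad_discr => [|t]; first exact: q0.
  have := I_le _ (FD t _ _ Fz (Fu n)); rewrite J_line //.
  by have [_] := uP n; move: n.+1%:R^-1 => en; lra.
have h5 := q0 _ Fz; have h6 := q0 _ Fxn.
have h7 : q (u n - x) (u n - x) * q z z <= e * q z z.
  by rewrite ler_wpM2r // ltW.
have h8 : n.+1%:R^-1 * q z z <= e * q z z by rewrite ler_wpM2r // ltW.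
have := sqr_ge0 (q (u n) z - q x z + (q (u n) z - l z)).
have {h3 h7} := le_trans h3 h7; have {h4 h8} := le_trans h4 h8.
clear h1 h2 h5 h6; nra.
Qed.

(* If the lower bound [s] were smaller than [al], Cauchy-Schwarz for
   [q - s] and the resolvent at [s] would improve [s]. *)
Lemma real_form_lower F q (c0 al : R) :
  real_form F q -> (forall x, F x -> c0 * nrm x ^+ 2 <= q x x) ->
  (forall m, m < al -> exists C : R, forall x, F x ->
     exists u, [/\ F u, (forall z, F z -> q u z - m * rip u z = rip x z)
                 & nrm u <= C * nrm x]) ->
  forall x, F x -> al * nrm x ^+ 2 <= q x x.
Proof.
move=> qf qc0 res; have [F0 FD ql qs] := qf.
(* The cap [m <= al] keeps [E] bounded above even when [F] contains only 0. *)
pose E := [set m | m <= al /\ forall x, F x -> m * nrm x ^+ 2 <= q x x].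
have Esup : has_sup E.
  split; last by exists al => m [].
  exists (Num.min c0 al); split=> [|x Fx]; first by rewrite ge_min lexx orbT.
  apply: le_trans (qc0 _ Fx); rewrite ler_wpM2r ?sqr_ge0 //.
  by rewrite ge_min lexx.
pose s := sup E.
have s_al : s <= al by apply: ge_sup; [case: Esup | move=> m []].
have qs0 x : F x -> s * nrm x ^+ 2 <= q x x.
  move=> Fx; rewrite -subr_le0; apply: (@le0_small _ (nrm x ^+ 2)) => e e0.
  have [m [_ mx] sm] := sup_adherent e0 Esup.
  have := mx _ Fx; have := sqr_ge0 (nrm x); rewrite -/s in sm.
  nra.
have [sal|sal] := ltP s al; last first.
  by move=> x Fx; rewrite (le_anti (_ : al <= s <= al)) ?sal //; apply: qs0.
have [C CP] := res _ sal.
pose C' := Num.max C 1.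
have C'0 : 0 < C' by rewrite lt_max ltr01 orbT.
have qs1 x : F x -> (s + C'^-1) * nrm x ^+ 2 <= q x x.
  move=> Fx; have [u [Fu ux uC]] := CP _ Fx.
  pose p x y := q x y + - s * rip x y.
  have pf : real_form F p by apply: real_form_add => //; apply: real_form_rip qf.
  have p0 y : F y -> 0 <= p y y.
    by move=> /qs0; rewrite /p -nrm_sqr mulNr subr_ge0.
  (* The choice of [u] gives p(u,x) = |x|^2 and p(u,u) = <x,u> <= C' |x|^2, so Cauchy-Schwarz reads
     |x|^4 <= C' |x|^2 p(x,x). *)
  have := real_form_CS pf p0 Fu Fx.
  rewrite {1 2}/p !mulNr !ux // -nrm_sqr => h1.
  have h2 : rip x u <= C' * nrm x ^+ 2.
    apply: le_trans (ler_norm _) _; apply: le_trans (ler_rip _ _) _.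
    rewrite mulrC expr2 mulrA ler_wpM2r ?nrm_ge0 //.
    by apply: le_trans uC _; rewrite ler_wpM2r ?nrm_ge0 // le_max lexx.
  have h3 : C'^-1 * nrm x ^+ 2 <= p x x.
    have [n0|n0] := eqVneq (nrm x) 0; first by rewrite n0 expr0n mulr0 p0.
    have np : 0 < nrm x ^+ 2 by rewrite exprn_gt0 // lt_def n0 nrm_ge0.
    rewrite mulrC ler_pdivrMr // -(ler_pM2l np) -expr2.
    apply: le_trans h1 _; rewrite mulrCA mulrC [X in _ <= X]mulrC.
    have := p0 _ Fx; nra.
  by move: h3; rewrite /p -nrm_sqr; lra.
have Em : E (Num.min al (s + C'^-1)).
  split=> [|x Fx]; first by rewrite ge_min lexx.
  apply: le_trans (qs1 _ Fx); rewrite ler_wpM2r ?sqr_ge0 //.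
  by rewrite ge_min lexx orbT.
have := ub_le_sup (proj2 Esup) Em; rewrite -/s leNgt lt_min sal /=.
by rewrite ltrDl invr_gt0 C'0.
Qed.

End RealForms.

(** * Operators given by their graphs *)

Section Operators.
Context {R : realType}.

Lemma le0_small1 (p k : R) : (forall e, 0 < e <= 1 -> p <= e * k) -> p <= 0.
Proof.
move=> pe; apply: (@le0_small _ _ `|k|) => e e0.
have m0 : 0 < Num.min e 1 by rewrite lt_min e0 ltr01.
apply: le_trans (pe (Num.min e 1) _) _; first by rewrite m0 ge_min lexx orbT.
apply: (@le_trans _ _ (Num.min e 1 * `|k|)).
  by rewrite ler_wpM2l ?ler_norm // ltW.
by rewrite ler_wpM2r // ge_min lexx.
Qed.

(** The modulus is linear in [e] with a constant depending on the limit pair only, which is the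
    shape [le0_small1] consumes; [e <= 1] absorbs the product of the two errors. *)
Lemma rip_near (H : hilbertType R) (e : R) (v w v' w' : H) :
  e <= 1 -> nrm (v - v') < e -> nrm (w - w') < e ->
  `|rip v w - rip v' w'| <= e * (nrm v + nrm w + 1).
Proof.
move=> e1 hv hw.
have -> : rip v w - rip v' w' = rip (v - v') w + rip v (w - w') - rip (v - v') (w - w').
  by rewrite !ripBl !ripBr; ring.
have n1 := ler_rip (v - v') w; have n2 := ler_rip v (w - w').
have n3 := ler_rip (v - v') (w - w').
apply: le_trans (ler_normB _ _) _; apply: le_trans (lerD (ler_normD _ _) (lexx _)) _.
have := nrm_ge0 (v - v'); have := nrm_ge0 (w - w'); have := nrm_ge0 v; have := nrm_ge0 w.
move: (nrm v) (nrm w) (nrm (v - v')) (nrm (w - w')) `|rip (v - v') w| `|rip v (w - w')| `|rip (v - v') (w - w')| n1 n2 n3 hv hw.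
move=> a b c d X Y Z n1 n2 n3 ce de b0 a0 d0 c0.
have : c * b <= e * b by rewrite ler_wpM2r // ltW.
have : a * d <= a * e by rewrite ler_wpM2l // ltW.
have : c * d <= e * 1 by apply: ler_pM => //; [exact: ltW | lra].
lra.
Qed.

Lemma Re_norm2 (V : normedModType R[i]) (c : R) (x : V) :
  c%:C * `|x| ^+ 2 = (c * nrm x ^+ 2)%:C.
Proof. by rewrite normE rmorphM rmorphXn. Qed.

Lemma dense_nrm_le (H : hilbertType R) (S : set H) (v : H) (k : R) : dense S ->
  0 <= k -> (forall w, S w -> rip v w ^+ 2 <= k ^+ 2 * nrm w ^+ 2) -> nrm v <= k.
Proof.
move=> dS k0 Sk; have nv := nrm_ge0 v.
suff : nrm v ^+ 2 - k * nrm v <= 0.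
  rewrite subr_le0 expr2; have [->//|nv0] := eqVneq (nrm v) 0.
  by rewrite ler_pM2r // lt_def nv0.
apply: (@le0_small _ _ (k + nrm v)) => e e0.
have [w [Sw vw]] := dense_nrm v dS e0.
have h1 : rip v w <= k * nrm w.
  apply: le_trans (ler_norm _) _.
  rewrite -(@ler_pXn2r _ 2) ?nnegrE ?mulr_ge0 ?nrm_ge0 //.
  by rewrite real_normK ?num_real // exprMn Sk.
have h2 : nrm w <= nrm v + e.
  have := nrmD (w - v) v; rewrite subrK nrm_distC; lra.
have h3 : rip v (v - w) <= nrm v * e.
  apply: le_trans (ler_norm _) _; apply: le_trans (ler_rip _ _) _.
  by rewrite ler_wpM2l // ltW.
have h4 : k * nrm w <= k * (nrm v + e) by rewrite ler_wpM2l.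
move: h3; rewrite ripBr -nrm_sqr; lra.
Qed.

Definition opv {V W : normedModType R[i]} (T : set (V * W)) (x : V) : W :=
  xget 0 [set y | T (x, y)].

Lemma opvP (V W : normedModType R[i]) (T : set (V * W)) x :
  dom T x -> T (x, opv T x).
Proof. by case=> y Txy; rewrite /opv; case: xgetP => [z -> //|/(_ y)]. Qed.

Lemma opv_eq (V W : normedModType R[i]) (T : set (V * W)) x y :
  single_valued T -> T (x, y) -> opv T x = y.
Proof. by move=> sT Txy; apply: sT (Txy); apply: opvP; exists y. Qed.

Lemma op_lin (V W : normedModType R[i]) (T : set (V * W)) (c : R[i]) x y x' y' :
  is_operator T -> T (x, y) -> T (x', y') -> T (c *: x + x', c *: y + y').
Proof. by case=> _ h _; apply: h. Qed.

Lemma op_sub (V W : normedModType R[i]) (T : set (V * W)) x y x' y' :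
  is_operator T -> T (x, y) -> T (x', y') -> T (x - x', y - y').
Proof.
move=> To Txy Txy'; have := op_lin (-1) To Txy' Txy.
by rewrite !scaleN1r !(addrC (- _)).
Qed.

Lemma opv_lin (V W : normedModType R[i]) (T : set (V * W)) (c : R[i]) x y :
  is_operator T -> dom T x -> dom T y ->
  opv T (c *: x + y) = c *: opv T x + opv T y.
Proof.
move=> To Tx Ty; apply: opv_eq; first by case: To.
by apply: op_lin => //; apply: opvP.
Qed.

Lemma adjoint_is_operator (H K : hilbertType R) (T : set (H * K)) :
  densely_defined T -> is_operator (adjoint T).
Proof.
move=> dT; split=> [x y _|c x y x' y' h h' z w Tzw|x y y' h h'] /=.
- by rewrite !linear0r.
- have /= hz := h _ _ Tzw; have /= hz' := h' _ _ Tzw.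
  by rewrite !linearDr !linearZr_LR /= hz hz'.
- apply/eqP; rewrite -subr_eq0; apply/eqP; apply: (dense_rip_eq0 dT) => z [w Tzw].
  have /= hz := h _ _ Tzw; have /= hz' := h' _ _ Tzw.
  by rewrite ripBr /rip -hz -hz' subrr.
Qed.

Lemma adjoint_closed (H K : hilbertType R) (T : set (H * K)) :
  closure (adjoint T) `<=` adjoint T.
Proof.
move=> [x y] /closure_nrmP cl z w Tzw /=.
(* Arbitrary [z'] and [w'] let the same limit argument serve the real part and, after multiplication
   by i, the imaginary part. *)
have key (z' : H) (w' : K) :
    (forall x' y', adjoint T (x', y') -> rip w' x' = rip z' y') ->
    rip w' x = rip z' y.
  move=> h; apply/eqP; rewrite -subr_eq0 -normr_le0; apply/eqP.
  apply/eqP; apply: (@le0_small1 _ (nrm w' + nrm x + 1 + (nrm z' + nrm y + 1))).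
  move=> e /andP[e0 e1]; have [x' [y' [Ty xx' yy']]] := cl _ e0.
  have n0 (V : normedModType R[i]) (v : V) : nrm (v - v) < e by rewrite subrr nrm0.
  have h1 := rip_near e1 (n0 _ w') xx'; have h2 := rip_near e1 (n0 _ z') yy'.
  rewrite mulrDr; apply: le_trans (lerD h1 h2).
  rewrite -(h _ _ Ty); move: (rip w' x') => t.
  have -> : rip w' x - rip z' y = (rip w' x - t) - (rip z' y - t) by ring.
  exact: ler_normB.
rewrite !innerE; congr (_ +i* _).
  by apply: key => x' y' /(_ _ _ Tzw) /=; rewrite /rip => ->.
congr (- _); apply: key => x' y' /(_ _ _ Tzw) /= h.
by apply: oppr_inj; rewrite -!Im_inner h.
Qed.

Lemma self_adjoint_rip (H : hilbertType R) (T : set (H * H)) x y x' y' :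
  self_adjoint T -> T (x, y) -> T (x', y') -> rip y x' = rip x y'.
Proof. by move=> [_ _ aT] Txy; rewrite -{1}aT => /(_ _ _ Txy) /=; rewrite /rip => ->. Qed.

Lemma self_adjoint_form (H : hilbertType R) (T : set (H * H)) :
  self_adjoint T -> real_form (dom T) (fun x y => rip (opv T x) y).
Proof.
move=> saT; have [To _ _] := saT; have [T0 _ _] := To; split.
- by exists 0.
- move=> r x y [x' Tx] [y' Ty]; exists (r%:C *: x' + y'); exact: op_lin.
- by move=> r x y z Tx Ty Tz; rewrite opv_lin // ripDl ripZl.
- move=> x y /opvP Tx /opvP Ty; rewrite (self_adjoint_rip saT Tx Ty); exact: ripC.
Qed.

Lemma resolvent_realP (V : normedModType R[i]) (T : set (V * V)) (m : R) :
  resolvent_set T m%:C -> exists C : R, forall v, exists u,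
    T (u, v + m%:C *: u) /\ nrm u <= C * nrm v.
Proof.
case=> [Tu [C TC]]; exists C => v; have [u [Tuv _]] := Tu v.
exists u; split; first exact: Tuv.
by have := TC _ _ Tuv; rewrite !normE -rmorphM lecR.
Qed.

(** The form of c2 - T lies between 0 and K |x|^2, so Cauchy-Schwarz against the dense domain bounds
    |(c2 - T) x| by K |x|. Thus [T] is bounded on its domain, and being densely defined and closed
    (as an adjoint) it is defined everywhere. *)
Lemma self_adjoint_bounded_dom (H : hilbertType R) (T : set (H * H)) (c1 c2 : R) :
  self_adjoint T ->
  (forall x y, T (x, y) -> c1 * nrm x ^+ 2 <= rip y x <= c2 * nrm x ^+ 2) ->
  dom T = setT.
Proof.
move=> saT cT; have [To dT aT] := saT.
pose K := `|c2 - c1|; pose q x y := c2 * rip x y + -1 * rip (opv T x) y.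
have qf : real_form (dom T) q.
  have tf := self_adjoint_form saT.
  case: tf => F0 FD tl ts; split=> // [r x y z Tx Ty Tz|x y Tx Ty].
    by rewrite /q tl // ripDl ripZl; ring.
  by rewrite /q ts // ripC.
have q0 x : dom T x -> 0 <= q x x.
  by move=> /opvP /cT /andP[_]; rewrite /q -nrm_sqr; lra.
have qK x : dom T x -> q x x <= K * nrm x ^+ 2.
  move=> /opvP /cT /andP[h _]; rewrite /q -nrm_sqr /K.
  have := ler_norm (c2 - c1); have := sqr_ge0 (nrm x); nra.
have K0 : 0 <= K by apply: normr_ge0.
have Tb x y : T (x, y) -> nrm y <= (K + `|c2|) * nrm x.
  move=> Txy; have Tx : dom T x by exists y.
  have yE : opv T x = y by apply: opv_eq => //; case: To.
  have -> : y = c2%:C *: x - (c2%:C *: x - y) by rewrite subKr.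
  rewrite mulrDl [X in _ <= X]addrC; apply: le_trans (nrmB _ _) _.
  rewrite nrmZ lerD2l; apply: (dense_nrm_le dT); first by rewrite mulr_ge0 ?nrm_ge0.
  move=> w Tw; have := real_form_CS qf q0 Tx Tw.
  rewrite {1}/q yE ripBl ripZl mulN1r => h; apply: le_trans h _.
  rewrite exprMn [X in _ <= X](_ : _ = (K * nrm x ^+ 2) * (K * nrm w ^+ 2)); last by ring.
  by apply: ler_pM; rewrite ?q0 ?qK.
apply/seteqP; split=> // x _.
have /choice[u uP] : forall n, exists z, dom T z /\ nrm (x - z) < n.+1%:R^-1.
  by move=> n; apply: dense_nrm => //; rewrite invr_gt0.
have K1 : 0 < K + `|c2| + 1 by rewrite ltr_wpDl // addr_ge0.
have uT n : T (u n, opv T (u n)) by apply: opvP; case: (uP n).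
have [e e0|v vP] := @cauchy_nrm_cvg _ H (fun n => opv T (u n)).
  have [|N NP] := @inv_succ_small R (e / (2 * (K + `|c2| + 1))).
    by rewrite divr_gt0 // mulr_gt0.
  exists N => m n Nm Nn; apply: le_lt_trans (Tb _ _ (op_sub To (uT m) (uT n))) _.
  have h : nrm (u m - u n) < e / (K + `|c2| + 1).
    apply: le_lt_trans (nrm_triangle x _ _) _; rewrite nrm_distC.
    have -> : e / (K + `|c2| + 1) = e / (2 * (K + `|c2| + 1)) + e / (2 * (K + `|c2| + 1)).
      by field; rewrite gt_eqF.
    by apply: ltrD; [case: (uP m) => _ /lt_trans|case: (uP n) => _ /lt_trans]; apply; apply: NP.
  rewrite ltr_pdivlMr // mulrC in h; apply: le_lt_trans h.
  by rewrite ler_wpM2r ?nrm_ge0 // lerDl.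
exists v; rewrite -aT; apply: adjoint_closed; rewrite aT.
apply/closure_nrmP => e e0.
have [N1 N1P] := inv_succ_small e0; have [N2 N2P] := (cvg_nrmP _ _).1 vP _ e0.
pose n := maxn N1 N2; exists (u n), (opv T (u n)); split=> //=.
  by have [_ h] := uP n; apply: lt_trans h (N1P _ (leq_maxl _ _)).
by rewrite nrm_distC; apply: N2P; exact: leq_maxr.
Qed.

End Operators.

(** * Forms and spectral bounds of self-adjoint operators *)

Section Forms.
Context {R : realType} {H : hilbertType R}.

Lemma symmetric_qform_real (q : qform H) : is_symmetric_qform q ->
  real_form (form_dom q) (fun x y => Re (q x y)).
Proof.
case=> F0 FD ql qs; split=> // [r x y Fx Fy|r x y z Fx Fy Fz|x y Fx Fy].
- exact: FD.
- by rewrite ql //; case: (q x z) => ? ? /=; case: (q y z) => ? ? /=; rewrite mul0r subr0.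
- by rewrite (qs y x) //; case: (q y x).
Qed.

Lemma symmetric_qform_Im (q : qform H) x : is_symmetric_qform q ->
  form_dom q x -> Im (q x x) = 0.
Proof.
case=> _ _ _ qs Fx; have := qs x x Fx Fx.
by case: (q x x) => p i [] /= h; apply/eqP; move/eqP: h; rewrite -addr_eq0 -mulr2n mulrn_eq0.
Qed.

Lemma qform_diagE (q : qform H) x : is_symmetric_qform q ->
  form_dom q x -> q x x = (Re (q x x))%:C.
Proof.
by move=> qs Fx; move: (symmetric_qform_Im qs Fx); case: (q x x) => p i /= ->.
Qed.

(** Coercivity of [s] makes an [s]-Cauchy sequence converge in [H], the first comparison makes it
    [q]-Cauchy, and the second turns [q]-convergence back into [s]-convergence. *)
Lemma closed_qform_complete (q : qform H) (s : H -> H -> R) (c K : R) :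
  is_symmetric_qform q -> closed_qform q -> real_form (form_dom q) s ->
  0 < c -> 0 < K -> (forall x, form_dom q x -> c * nrm x ^+ 2 <= s x x) ->
  (forall x, form_dom q x -> `|Re (q x x)| <= K * s x x) ->
  (forall x, form_dom q x -> s x x <= K * (`|Re (q x x)| + nrm x ^+ 2)) ->
  form_complete (form_dom q) s.
Proof.
move=> qs qc sf c0 K0 cs qls slq u Fu us.
have FB x y : form_dom q x -> form_dom q y -> form_dom q (x - y).
  by move=> Fx Fy; exact: real_form_subr sf Fx Fy.
have qE x : form_dom q x -> `|q x x| = `|Re (q x x)|%:C.
  by move=> Fx; rewrite (qform_diagE qs Fx) normc_def /= expr0n addr0 sqrtr_sqr.
have [e e0|l ul] := @cauchy_nrm_cvg _ H u.
  have [|N NP] := us (c * e ^+ 2); first by rewrite mulr_gt0 // exprn_gt0.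
  exists N => m n Nm Nn; rewrite -(@ltr_pXn2r _ 2) ?nnegrE ?nrm_ge0 ?(ltW e0) //.
  rewrite -(ltr_pM2l c0); apply: le_lt_trans (NP _ _ Nm Nn); exact/cs/FB.
have [e e0|Fl ql] := qc u l Fu ul.
  have [|N NP] := us (e / K); first by rewrite divr_gt0.
  exists N => m n Nm Nn; rewrite qE ?ltcR; last exact: FB.
  apply: le_lt_trans (qls _ (FB _ _ _ _)) _; rewrite ?Fu //.
  by rewrite mulrC -ltr_pdivlMr //; apply: NP.
exists l => // e e0.
have eK : 0 < e / K / 2 by rewrite !divr_gt0.
have [N1 N1P] := ql _ eK.
(* The 1 ensures that a norm below [d] has its square below [e / K / 2]. *)
pose d := Num.min 1 (e / K / 2).
have d0 : 0 < d by rewrite lt_min ltr01.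
have [N2 N2P] := (cvg_nrmP _ _).1 ul _ d0.
exists (maxn N1 N2) => n; rewrite geq_max => /andP[/N1P h1 /N2P h2].
have Fn := FB _ _ (Fu n) Fl.
apply: le_lt_trans (slq _ Fn) _; rewrite mulrC -ltr_pdivlMr //.
rewrite qE // ltcR in h1.
have h3 : nrm (u n - l) ^+ 2 < e / K / 2.
  move: h2; rewrite lt_min => /andP[g1 g2]; apply: le_lt_trans g2.
  by rewrite expr2 ler_piMl ?nrm_ge0 // ltW.
by rewrite [X in _ < X]splitr; apply: ltrD.
Qed.

(* [semibounded_qform] may only provide an upper bound; then [A] is bounded,
   hence everywhere defined, and the form is [inner (A x) x]. *)
Lemma form_bounded_below (A : set (H * H)) (q : qform H) :
  self_adjoint A -> bounded_from_below A -> is_form_of A q ->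
  exists c : R, forall x, form_dom q x -> c * nrm x ^+ 2 <= Re (q x x).
Proof.
move=> saA [c1 Ac1] [qs [c2 [qc|qc]] _ _ Aq].
  by exists c2 => x /qc; rewrite Re_norm2 lecE => /andP[_].
have AE x y : A (x, y) -> form_dom q x /\ rip y x = Re (q x x).
  by move=> /Aq[Fx qx]; rewrite (qx _ Fx).
exists c1 => x Fx.
have dA : dom A = setT.
  apply: (@self_adjoint_bounded_dom _ _ _ c1 c2) => // z y Azy.
  have [Fz yz] := AE _ _ Azy; rewrite {2}yz.
  have := Ac1 _ _ Azy; have := qc _ Fz.
  by rewrite !Re_norm2 !lecE => /andP[_ /= ->] /andP[_ /= ->].
have [y Axy] : dom A x by rewrite dA.
have [_ <-] := AE _ _ Axy; have := Ac1 _ _ Axy.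
by rewrite Re_norm2 lecE => /andP[_].
Qed.

Lemma resolvent_below_min (T : set (H * H)) (al m : R) :
  is_min_spectrum T al -> m < al -> resolvent_set T m%:C.
Proof.
move=> [_ sT] m_al; apply: contrapT => /sT; rewrite lecR => h.
by move: m_al; rewrite ltNge h.
Qed.

Lemma resolvent_above_max (T : set (H * H)) (dl m : R) :
  is_max_spectrum T dl -> dl < m -> resolvent_set T m%:C.
Proof.
move=> [_ sT] m_dl; apply: contrapT => /sT; rewrite lecR => h.
by move: m_dl; rewrite ltNge h.
Qed.

(** Because [q] represents [A], the resolvent of [A] at [m < al] solves the form equation that
    [real_form_lower] asks for. *)
Lemma form_ge_min_spectrum (A : set (H * H)) (q : qform H) (al : R) :
  self_adjoint A -> bounded_from_below A -> is_form_of A q ->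
  is_min_spectrum A al ->
  forall x, form_dom q x -> al * nrm x ^+ 2 <= Re (q x x).
Proof.
move=> saA bA qA minA; have [c qc] := form_bounded_below saA bA qA.
have [qs _ _ _ Aq] := qA.
apply: (real_form_lower (symmetric_qform_real qs) qc) => m m_al.
have [C CP] := resolvent_realP (resolvent_below_min minA m_al).
exists C => x Fx; have [u [/Aq[Fu qu] uC]] := CP x; exists u; split=> // z Fz.
by rewrite qu //; have := ripDl x (m%:C *: u) z; rewrite ripZl /rip => ->; ring.
Qed.

(** [real_form_lower] asks for no completeness, so it applies to [- D] directly on the operator
    domain. *)
Lemma le_max_spectrum (D : set (H * H)) (dl : R) :
  self_adjoint D -> bounded_from_above D -> is_max_spectrum D dl ->
  forall x y, D (x, y) -> rip y x <= dl * nrm x ^+ 2.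
Proof.
move=> saD [c Dc] maxD; have [Do _ _] := saD.
have Df := self_adjoint_form saD.
pose q x y := -1 * rip (opv D x) y.
have qf : real_form (dom D) q.
  case: Df => F0 FD ql qs; split=> // [r x y z Fx Fy Fz|x y Fx Fy].
    by rewrite /q ql //; ring.
  by rewrite /q qs.
have lower x : dom D x -> - dl * nrm x ^+ 2 <= q x x.
  apply: (@real_form_lower _ _ _ _ (- c)) => // [z /opvP /Dc|m m_dl].
    by rewrite Re_norm2 lecE /q => /andP[_ /=]; rewrite -/(rip _ _); lra.
  have [|C CP] := resolvent_realP (@resolvent_above_max _ _ (- m) maxD _).
    by rewrite ltrNr.
  exists C => z Dz; have [u [Du uC]] := CP (- z); exists u; split.
  - by exists (- z + (- m)%:C *: u).
  - move=> w Dw; rewrite /q (opv_eq _ Du); last by case: Do.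
    by rewrite ripDl ripNl ripZl; ring.
  - by rewrite -(nrmN z).
move=> x y Dxy; have := lower x; rewrite /q (opv_eq _ Dxy); last by case: Do.
by move=> h; have {}h := h (ex_intro _ y Dxy); lra.
Qed.

End Forms.

(* Up to the factor [g - dl], the second hypothesis says that the lower bound
   [qa x x - g * |x|^2 - (a * |x|^2 + b * qa x x) / (g - dl)] of the Schur
   complement is positive when [qa x x = lam * |x|^2]; the slack [e] is kept to
   make [J (M0 - g)] strictly positive in both components. *)
Lemma gap_constant (R : realFieldType) (a b dl g lam : R) :
  b < g - dl -> a + g * (g - dl) < lam * (g - dl - b) ->
  exists2 e : R, 0 < e < g - dl - b &
    a + (g + e) * (g - dl - e) <= lam * (g - dl - e - b).
Proof.
move=> bg lg; pose P := lam * (g - dl - b) - (a + g * (g - dl)).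
have P0 : 0 < P by rewrite subr_gt0.
pose k := `|lam - dl| + 1; have k0 : 0 < k by rewrite ltr_wpDl.
pose e := Num.min ((g - dl - b) / 2) (P / k).
have e0 : 0 < e by rewrite lt_min !divr_gt0 // subr_gt0.
exists e.
  rewrite e0; apply: le_lt_trans (_ : (g - dl - b) / 2 < _); first by rewrite ge_min lexx.
  by lra.
have ek : e * k <= P by rewrite -ler_pdivlMr // ge_min lexx orbT.
have := ler_norm (lam - dl); move: ek; rewrite /k mulrDr mulr1.
have : e * (lam - dl) <= e * `|lam - dl| by rewrite ler_wpM2l ?ler_norm // ltW.
rewrite /P; nra.
Qed.

(** With t = b dl + b^2 + a, the difference of the two sides factors: for lam = - a/b it is (- a/b -
    g)(g - dl), and for lam = al it is (g - dl - b)(al - b - g) - t. In the second case both factors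
    exceed r = sqrt(t_+), so the product exceeds t; this is where the endpoints of the interval come
    from. *)
Lemma gap_alternative (R : realType) (a b al dl g : R) :
  0 <= b -> (b = 0 -> 0 <= a) ->
  b * dl + b ^+ 2 + a < 0 \/
    b + Num.sqrt (pos_part (b * dl + b ^+ 2 + a)) < (al - dl) / 2 ->
  mu a b dl < g < mu_plus a b al dl ->
  b < g - dl /\ ((0 < b /\ a + g * (g - dl) < (- a / b) * (g - dl - b)) \/
    a + g * (g - dl) < al * (g - dl - b)).
Proof.
move=> b0 ba gap; set t := b * dl + b ^+ 2 + a in gap *.
pose r := Num.sqrt (pos_part t); rewrite -/r in gap.
have r0 : 0 <= r by apply: sqrtr_ge0.
have rt : t <= r ^+ 2 by rewrite sqr_sqrtr /pos_part le_max ?lexx ?orbT.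
rewrite /mu /mu_plus -/t -/r => /andP[g1].
have bg : b < g - dl by lra.
have alt1 : 0 < b -> g < - a / b ->
    a + g * (g - dl) < (- a / b) * (g - dl - b).
  move=> bp gab; rewrite -subr_gt0.
  have -> : - a / b * (g - dl - b) - (a + g * (g - dl)) = (- a / b - g) * (g - dl).
    by field; rewrite gt_eqF.
  by rewrite mulr_gt0 ?subr_gt0 //; lra.
have alt2 : g < al - b - r -> a + g * (g - dl) < al * (g - dl - b).
  move=> gr; rewrite -subr_gt0.
  have -> : al * (g - dl - b) - (a + g * (g - dl)) =
      (g - dl - b) * (al - b - g) - t by rewrite /t; ring.
  rewrite subr_gt0; apply: le_lt_trans rt _; rewrite expr2.
  by apply: ltr_pM => //; lra.
move=> g2; split=> //; move: g2.
rewrite /condA1 /condA2 -/t -/r.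
have [A1|A1] /= := boolP (t <= 0); last first.
  have [A2|A2] /= := boolP (b + r <= (al - dl) / 2); first by move=> /alt2; right.
  case: gap => [t0|gap]; first by move: A1; rewrite ltW.
  by rewrite -ltNge in A2; lra.
have rz : r = 0 by rewrite /r /pos_part max_r // sqrtr0.
have [bp|bp] /= := boolP (0 < b).
  have [A2|A2] /= := boolP (b + r <= (al - dl) / 2).
    rewrite lt_max => /orP[/(alt1 bp)|h]; [by left | right; apply: alt2; lra].
  by move=> /(alt1 bp); left.
have [A2|A2] /= := boolP (b + r <= (al - dl) / 2); first by move=> /alt2; right.
have {bp} bz : b = 0 by apply/eqP; rewrite eq_le b0 leNgt bp.
case: gap => [|gap]; last by rewrite -ltNge in A2; lra.
by have := ba bz; rewrite /t bz; lra.
Qed.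

(** * The block operator *)

Lemma subr_subACA (V : zmodType) (x y z t : V) :
  x - y - (z - t) = x - z - (y - t).
Proof. by rewrite !opprB [t - z]addrC addrACA [t - y]addrC. Qed.

Lemma nrm_pair (R : realType) (V W : normedModType R[i]) (p : V * W) :
  nrm p = Num.max (nrm p.1) (nrm p.2).
Proof.
rewrite {1}/nrm prod_normE /= !normE; have [h|h] := leP (nrm p.1) (nrm p.2).
  by rewrite max_r // lecR.
by rewrite max_l // lecR ltW.
Qed.

Lemma nrm_fst (R : realType) (V W : normedModType R[i]) (p : V * W) :
  nrm p.1 <= nrm p.
Proof. by rewrite nrm_pair le_max lexx. Qed.

Lemma nrm_snd (R : realType) (V W : normedModType R[i]) (p : V * W) :
  nrm p.2 <= nrm p.
Proof. by rewrite nrm_pair le_max lexx orbT. Qed.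

Section Block.
Context {R : realType} {H1 H2 : hilbertType R}.
Context (A : set (H1 * H1)) (B : set (H2 * H1)) (D : set (H2 * H2)).
Context (qa : qform H1) (a b al dl g e : R).

Local Notation F := (form_dom qa).
Local Notation ra x z := (Re (qa x z)).
Local Notation bs := (opv (adjoint B)).
Local Notation M0 := (block_op A B D).

Context (A_sa : self_adjoint A) (D_sa : self_adjoint D).
Context (B_op : is_operator B) (B_dense : densely_defined B).
Context (qa_form : is_form_of A qa) (qa_domB : F `<=` dom (adjoint B)).
Context (b_ge0 : 0 <= b) (e_gt0 : 0 < e) (e_lt : e < g - dl - b).
Context (bs_bound : forall x, F x -> nrm (bs x) ^+ 2 <= a * nrm x ^+ 2 + b * ra x x).
Context (qa_ge : forall x, F x -> al * nrm x ^+ 2 <= ra x x).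
Context (D_le : forall x y, D (x, y) -> rip y x <= dl * nrm x ^+ 2).
Context (bs_gap : forall x, F x ->
  nrm (bs x) ^+ 2 <= (g - dl - e) * (ra x x - (g + e) * nrm x ^+ 2)).
Context (A_res : resolvent_set A (al - 1)%:C) (D_res : resolvent_set D g%:C).
Context (B_core : forall y y', D (y, y') -> forall d : R, 0 < d ->
  exists z z', [/\ dom B z, D (z, z'), nrm (y - z) < d & nrm (y' - z') < d]).

Lemma A_op : is_operator A. Proof. by case: A_sa. Qed.
Lemma D_op : is_operator D. Proof. by case: D_sa. Qed.
Lemma Bs_op : is_operator (adjoint B). Proof. exact: adjoint_is_operator. Qed.

Lemma qa_sym : is_symmetric_qform qa. Proof. by case: qa_form. Qed.

Lemma qa_real : real_form F (fun x z => ra x z).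
Proof. exact: symmetric_qform_real qa_sym. Qed.

Lemma A_qa x y : A (x, y) -> F x /\ forall z, F z -> ra x z = rip y z.
Proof. by case: qa_form => _ _ _ _ h /h[Fx qx]; split=> // z /qx ->. Qed.

Lemma bsP x : F x -> adjoint B (x, bs x).
Proof. by move=> /qa_domB /opvP. Qed.

Lemma bs_lin (r : R) x y : F x -> F y -> bs (r%:C *: x + y) = r%:C *: bs x + bs y.
Proof. by move=> /qa_domB Fx /qa_domB Fy; rewrite opv_lin //; exact: Bs_op. Qed.

Lemma bs_sub x y : F x -> F y -> bs (x - y) = bs x - bs y.
Proof. by move=> Fx Fy; rewrite subE bs_lin // -subE. Qed.

Lemma rip_bs x y z : F x -> B (y, z) -> rip z x = rip y (bs x).
Proof. by move=> /bsP h /h /=; rewrite /rip => ->. Qed.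

(** The sign change in the second component makes the operator the symmetric matrix with diagonal A
    - g, g - D and off-diagonal B, B^*. The cross term is absorbed by completing the square with
    weight [g - dl - e], and [bs_gap] pays for |B^* x|^2 divided by that weight. *)
Lemma block_coercive w v : M0 (w, v) ->
  e * (nrm w.1 ^+ 2 + nrm w.2 ^+ 2) <=
    rip (v.1 - g%:C *: w.1) w.1 - rip (v.2 - g%:C *: w.2) w.2.
Proof.
case: w v => x y [_ _] [Ax [Bsx [By [Dy [/= Axy Bxy Byz Dyy [-> ->]]]]]].
have [Fx qx] := A_qa Axy.
have Bsx_eq : Bsx = bs x by rewrite (opv_eq _ Bxy) //; case: Bs_op.
rewrite !ripBl !ripZl !ripDl ripNl -(qx _ Fx) (rip_bs Fx Byz) Bsx_eq.
rewrite (ripC (bs x)) -!nrm_sqr.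
have h1 := D_le Dyy; have h2 := bs_gap Fx; have h3 := ler_rip y (bs x).
set t := g - dl - e in h2; have t0 : 0 < t by rewrite /t; move: e_lt b_ge0; lra.
have h4 : - (2 * rip y (bs x)) <= t * nrm y ^+ 2 + (ra x x - (g + e) * nrm x ^+ 2).
  have h5 : nrm (bs x) ^+ 2 / t <= ra x x - (g + e) * nrm x ^+ 2.
    by rewrite ler_pdivrMr // mulrC.
  apply: (@le_trans _ _ (t * nrm y ^+ 2 + nrm (bs x) ^+ 2 / t)); last by rewrite lerD2l.
  have : 0 <= (t * nrm y - nrm (bs x)) ^+ 2 / t by rewrite divr_ge0 ?sqr_ge0 // ltW.
  have -> : (t * nrm y - nrm (bs x)) ^+ 2 / t =
      t * nrm y ^+ 2 + nrm (bs x) ^+ 2 / t - 2 * (nrm y * nrm (bs x)).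
    by field; rewrite gt_eqF.
  have := ler_norm (- rip y (bs x)); rewrite normrN.
  move: (nrm (bs x) ^+ 2 / t) (nrm y * nrm (bs x)) h3 => X Y h3; lra.
by move: h4; rewrite /t; lra.
Qed.

(** Needed because [0 <= z] in [R[i]] includes a vanishing imaginary part; the two off-diagonal
    terms are conjugate to each other. *)
Lemma block_krein_Im w v : M0 (w, v) ->
  Im (krein_inner (v - g%:C *: w) w) = 0.
Proof.
case: w v => x y [_ _] [Ax [Bsx [By [Dy [/= Axy Bxy Byz Dyy [-> ->]]]]]].
have saI (H : hilbertType R) (T : set (H * H)) u u' : self_adjoint T -> T (u, u') ->
    Im (inner u' u) = 0.
  move=> [_ _ aT] Tu; have := Tu; rewrite -{1}aT => /(_ _ _ Tu) /=.
  rewrite (innerC u' u); case: (inner u' u) => p i [] /= h.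
  by apply/eqP; move/eqP: h; rewrite -addr_eq0 -mulr2n mulrn_eq0.
have h1 := saI _ _ _ _ A_sa Axy; have h2 := saI _ _ _ _ D_sa Dyy.
have h3 : inner By x = (inner Bsx y)^*%C by rewrite -innerC; exact: Bxy Byz.
rewrite /krein_inner /= !linearBl !linearDl !linearNl /= !linearZl_LR /=.
rewrite h3 !inner_xx.
move: h1 h2; case: (inner Ax x) => ? ? /= ->; case: (inner Dy y) => ? ? /= ->.
by case: (inner Bsx y) => ? ? /=; ring.
Qed.

Lemma block_krein_nonneg : krein_nonnegative (op_shift (closure M0) g%:C).
Proof.
move=> w v /closure_nrmP cl.
have near (f : H1 * H2 -> H1 * H2 -> R) : (exists k : R, forall d v' w', 0 < d <= 1 ->
    nrm (v - v') < d -> nrm (w - w') < d -> `|f v w - f v' w'| <= d * k) ->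
    exists k : R, forall d, 0 < d <= 1 -> exists w' v',
      M0 (w', v') /\ `|f v w - f (v' - g%:C *: w') w'| <= d * k.
  move=> [k fk]; exists k => d /andP[d0 d1].
  have k0 : 0 < 1 + `|g| by rewrite ltr_wpDr.
  (* Undoing the shift by [g] multiplies the approximation error by at most 1 + |g|. *)
  have d2 : 0 < d / (1 + `|g|) by rewrite divr_gt0.
  have dE : d / (1 + `|g|) + `|g| * (d / (1 + `|g|)) = d by field; rewrite gt_eqF.
  have [w' [v' [/= Mw ww vv]]] := cl _ d2; exists w', v'; split=> //.
  apply: fk; first by rewrite d0.
    have -> : v - (v' - g%:C *: w') = (v + g%:C *: w - v') - g%:C *: (w - w').
      by rewrite scalerBr [in RHS]addrAC addrKA opprK opprB addrA addrAC.
    apply: le_lt_trans (nrmB _ _) _; rewrite nrmZ -[X in _ < X]dE.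
    by apply: ltr_leD => //; rewrite ler_wpM2l // ltW.
  apply: lt_le_trans ww _; rewrite -[X in _ <= X]dE lerDl mulr_ge0 //.
  exact: ltW.
have krein_near (v0 w0 : H1 * H2) : exists k : R, forall d v' w', 0 < d <= 1 ->
    nrm (v0 - v') < d -> nrm (w0 - w') < d ->
    `|(rip v0.1 w0.1 - rip v0.2 w0.2) - (rip v'.1 w'.1 - rip v'.2 w'.2)| <= d * k.
  exists (nrm v0.1 + nrm w0.1 + 1 + (nrm v0.2 + nrm w0.2 + 1)) => d v' w'.
  move=> /andP[d0 d1] vv ww.
  have h1 : `|rip v0.1 w0.1 - rip v'.1 w'.1| <= d * (nrm v0.1 + nrm w0.1 + 1).
    by apply: rip_near => //; [apply: le_lt_trans (nrm_fst _) vv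
                              |apply: le_lt_trans (nrm_fst _) ww].
  have h2 : `|rip v0.2 w0.2 - rip v'.2 w'.2| <= d * (nrm v0.2 + nrm w0.2 + 1).
    by apply: rip_near => //; [apply: le_lt_trans (nrm_snd _) vv
                              |apply: le_lt_trans (nrm_snd _) ww].
  rewrite mulrDr; apply: le_trans (lerD h1 h2).
  by rewrite subr_subACA; apply: ler_normB.
have ReE (v0 w0 : H1 * H2) :
    krein_inner v0 w0 = (rip v0.1 w0.1 - rip v0.2 w0.2) +i*
      - (rip ('i%C *: v0).1 w0.1 - rip ('i%C *: v0).2 w0.2).
  by rewrite /krein_inner !innerE; apply/eqP; rewrite eq_complex /= eqxx opprB /= opprK addrC.
(* Imaginary part and sign of the real part pass to the limit separately; up to sign, the imaginary
   part is the real functional at ['i%C *: v]. *)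
rewrite ReE lecE /=; apply/andP; split.
  have [|k kP] := near (fun v w => rip ('i%C *: v).1 w.1 - rip ('i%C *: v).2 w.2).
    have [k kP] := krein_near ('i%C *: v) w; exists k => d v' w' d01 vv ww.
    by apply: kP => //; rewrite -scalerBr normZi.
  rewrite oppr_eq0 -normr_le0; apply: (@le0_small1 _ _ k) => d /kP[w' [v' [Mw]]].
  have := block_krein_Im Mw; rewrite ReE /= => /eqP; rewrite oppr_eq0 => /eqP ->.
  by rewrite subr0.
have [|k kP] := near (fun v w => rip v.1 w.1 - rip v.2 w.2); first exact: krein_near.
rewrite -oppr_le0; apply: (@le0_small1 _ _ k) => d /kP[w' [v' [Mw]]].
move=> h; apply: le_trans _ h; have := block_coercive Mw.
have := ler_norm (- (rip v.1 w.1 - rip v.2 w.2 - (rip (v' - g%:C *: w').1 w'.1 - rip (v' - g%:C *: w').2 w'.2))).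
rewrite normrN /=.
have : 0 <= e * (nrm w'.1 ^+ 2 + nrm w'.2 ^+ 2) by rewrite mulr_ge0 ?addr_ge0 ?sqr_ge0 // ltW.
lra.
Qed.

Lemma block_sub w v w' v' : M0 (w, v) -> M0 (w', v') -> M0 (w - w', v - v').
Proof.
case: w w' => x y [x' y'].
move=> [Ax [Bx [By [Dy [/= h1 h2 h3 h4 ->]]]]].
move=> [Ax' [Bx' [By' [Dy' [/= h1' h2' h3' h4' ->]]]]].
exists (Ax - Ax'), (Bx - Bx'), (By - By'), (Dy - Dy'); split=> /=.
- exact: op_sub A_op h1 h1'.
- exact: op_sub Bs_op h2 h2'.
- exact: op_sub B_op h3 h3'.
- exact: op_sub D_op h4 h4'.
- by rewrite [LHS]surjective_pairing /=; congr (_, _); rewrite !opprD ?opprK addrACA.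
Qed.

(** The 2 counts the components: each real inner product is at most the product of the maximum
    norms. *)
Lemma block_bound u v : op_shift (closure M0) g%:C (u, v) -> nrm u <= 2 / e * nrm v.
Proof.
have bound0 w f : M0 (w, f) -> nrm w <= 2 / e * nrm (f - g%:C *: w).
  move=> Mw; have := block_coercive Mw; set f' := f - g%:C *: w.
  have -> : f.1 - g%:C *: w.1 = f'.1 by [].
  have -> : f.2 - g%:C *: w.2 = f'.2 by [].
  move=> h.
  have h1 : `|rip f'.1 w.1| <= nrm f' * nrm w.
    by apply: le_trans (ler_rip _ _) _; apply: ler_pM; rewrite ?nrm_ge0 ?nrm_fst.
  have h2 : `|rip f'.2 w.2| <= nrm f' * nrm w.
    by apply: le_trans (ler_rip _ _) _; apply: ler_pM; rewrite ?nrm_ge0 ?nrm_snd.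
  have h3 : nrm w ^+ 2 <= nrm w.1 ^+ 2 + nrm w.2 ^+ 2.
    have s1 := sqr_ge0 (nrm w.1); have s2 := sqr_ge0 (nrm w.2).
    rewrite (nrm_pair w); have [_|_] := leP (nrm w.1) (nrm w.2); lra.
  have h4 : e * nrm w ^+ 2 <= 2 * nrm f' * nrm w.
    have : e * nrm w ^+ 2 <= e * (nrm w.1 ^+ 2 + nrm w.2 ^+ 2) by rewrite ler_pM2l.
    have := ler_norm (rip f'.1 w.1); have := ler_norm (- rip f'.2 w.2).
    by rewrite normrN; lra.
  have [->|w0] := eqVneq (nrm w) 0; first by rewrite mulr_ge0 ?nrm_ge0 ?divr_ge0 // ltW.
  have wp : 0 < nrm w by rewrite lt_def w0 nrm_ge0.
  rewrite mulrAC ler_pdivlMr // mulrC -(ler_pM2r wp).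
  by apply: le_trans h4; rewrite -mulrA -expr2.
move=> /closure_nrmP cl; rewrite -subr_le0.
pose k := 1 + 2 / e * (1 + `|g|).
apply: (@le0_small _ _ k) => d d0.
have [w [f [/= Mw uw vf]]] := cl _ d0.
have h1 := bound0 _ _ Mw.
have h2 : nrm u <= d + nrm w.
  have := nrmD (u - w) w; rewrite subrK; lra.
have h3 : nrm (f - g%:C *: w) <= nrm v + d + `|g| * d.
  have -> : f - g%:C *: w = v - (v + g%:C *: u - f) + g%:C *: (u - w).
    by rewrite scalerBr -(addrA v _ (- f)) opprD (addrA v (- v)) subrr add0r opprB subrKA.
  apply: le_trans (nrmD _ _) _; apply: lerD; last by rewrite nrmZ ler_wpM2l // ltW.
  by apply: le_trans (nrmB _ _) _; rewrite lerD2l ltW.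
have h4 : 2 / e * nrm (f - g%:C *: w) <= 2 / e * (nrm v + d + `|g| * d).
  by rewrite ler_wpM2l // divr_ge0 // ltW.
rewrite /k; lra.
Qed.

(** Differences are taken between approximants in [M0], which is linear; [block_bound] then applies
    with right-hand side 0. *)
Lemma block_unique u u' v : op_shift (closure M0) g%:C (u, v) ->
  op_shift (closure M0) g%:C (u', v) -> u = u'.
Proof.
move=> /closure_nrmP cu /closure_nrmP cu'.
suff /block_bound : op_shift (closure M0) g%:C (u - u', 0).
  rewrite nrm0 mulr0 => h; apply/eqP; rewrite -subr_eq0; apply/eqP.
  by apply: nrm_eq0; apply/eqP; rewrite eq_le h nrm_ge0.
apply/closure_nrmP => d d0 /=; have d2 : 0 < d / 2 by rewrite divr_gt0.
have [w [f [/= Mw uw vf]]] := cu _ d2; have [w' [f' [/= Mw' uw' vf']]] := cu' _ d2.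
exists (w - w'), (f - f'); split; first exact: block_sub.
  rewrite subr_subACA.
  by apply: le_lt_trans (nrmB _ _) _; rewrite [X in _ < X]splitr ltrD.
have -> : 0 + g%:C *: (u - u') - (f - f') =
    (v + g%:C *: u - f) - (v + g%:C *: u' - f').
  by rewrite add0r scalerBr subr_subACA -(addrA v _ (- f)) -(addrA v _ (- f')) [v + (_ *: u - f)]addrC addrKA.
by apply: le_lt_trans (nrmB _ _) _; rewrite [X in _ < X]splitr ltrD.
Qed.


(* Solve [(A - m) x' = f - m *: x - B z] with [z \in dom B] close to [y];
   then [x' - x] is controlled in the form norm by [y - z]. *)
Lemma weak_solution_closure x y y' f : F x -> D (y, y') ->
  (forall z, F z -> ra x z + rip y (bs z) = rip f z) ->
  closure M0 ((x, y), (f, - bs x + y')).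
Proof.
move=> Fx Dy wx; apply/closure_nrmP => d d0.
(* At [m = al - 1] the shifted form dominates |u|^2, and [K] bounds |B^* u|^2 by that form. The
   constant [k] exceeds 1, K, |m| K and K + 1, the factors of [eta] in the four component errors. *)
pose m := al - 1; pose K : R := `|a + b * m| + b + 1; pose k : R := (`|m| + 2) * K + 1.
have K1 : 1 <= K by rewrite lerDr addr_ge0.
have K0 : 0 < K by apply: lt_le_trans K1.
have mK : 0 <= `|m| * K by rewrite mulr_ge0 // ltW.
have k0 : 0 < k by rewrite /k mulrDl; lra.
pose eta := d / k; have eta0 : 0 < eta by rewrite divr_gt0.
have eta_d c : c < k -> c * eta < d.
  by move=> ck; rewrite /eta mulrA ltr_pdivrMr // mulrC ltr_pM2l.
have [z [z' [[h Bz] Dz yz yz']]] := B_core Dy eta0.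
have [C /(_ (f - m%:C *: x - h))[x' [Ax' _]]] := resolvent_realP A_res.
rewrite -/m in Ax'; have [Fx' qx'] := A_qa Ax'.
have Fd := real_form_subr qa_real Fx' Fx; set u := x' - x in Fd.
have ux' : f - m%:C *: x - h + m%:C *: x' = f - h + m%:C *: u.
  by rewrite scalerBr (addrAC f) -!addrA [- _ + m%:C *: x']addrC.
rewrite ux' in Ax' qx'.
(* The weak equation for [x] is subtracted from the strong one for [x']: the right-hand side [f]
   cancels and only [y - z] remains. *)
have qu v : F v -> ra u v = m * rip u v + rip (y - z) (bs v).
  move=> Fv; rewrite (real_formB qa_real) // qx' //.
  by rewrite ripDl ripBl ripZl (rip_bs Fv Bz) -(wx _ Fv) (ripBl y z); ring.
pose P := ra u u - m * nrm u ^+ 2.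
have uP : nrm u ^+ 2 <= P by have := qa_ge Fd; rewrite /P /m; lra.
have n0 := sqr_ge0 (nrm u).
have bP : nrm (bs u) ^+ 2 <= K * P.
  apply: le_trans (bs_bound Fd) _.
  have -> : a * nrm u ^+ 2 + b * ra u u = (a + b * m) * nrm u ^+ 2 + b * P.
    by rewrite /P; ring.
  have h1 : (a + b * m) * nrm u ^+ 2 <= `|a + b * m| * nrm u ^+ 2.
    by rewrite ler_wpM2r // ler_norm.
  have h2 : `|a + b * m| * nrm u ^+ 2 <= `|a + b * m| * P by rewrite ler_wpM2l.
  by rewrite /K; move: n0 uP h1 h2; lra.
have Peta : P <= K * eta ^+ 2.
  have [P0|P0] := leP P 0.
    by apply: le_trans P0 _; rewrite mulr_ge0 ?sqr_ge0 // ltW.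
  rewrite -(ler_pM2r P0) -expr2.
  (* Testing [qu] with [u] itself gives P = <y - z, B^* u>, hence P^2 <= eta^2 K P. *)
  have -> : P ^+ 2 = rip (y - z) (bs u) ^+ 2.
    by rewrite /P qu // nrm_sqr; congr (_ ^+ 2); ring.
  apply: le_trans (rip_CS _ _) _; 
  rewrite [X in _ <= X](_ : _ = eta ^+ 2 * (K * P)); last by ring.
  apply: ler_pM; rewrite ?sqr_ge0 //.
  by rewrite ler_pXn2r ?nnegrE ?nrm_ge0 // ltW.
have Ke : K * eta ^+ 2 <= (K * eta) ^+ 2.
  by rewrite [X in _ <= X]exprMn ler_wpM2r ?sqr_ge0 // expr2 ler_peMl // ltW.
have Keta0 : 0 <= K * eta by rewrite mulr_ge0 // ltW.
have u_le : nrm u <= K * eta.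
  rewrite -(@ler_pXn2r _ 2) ?nnegrE ?nrm_ge0 //.
  exact: le_trans uP (le_trans Peta Ke).
have bu_le : nrm (bs u) <= K * eta.
  rewrite -(@ler_pXn2r _ 2) ?nnegrE ?nrm_ge0 //; apply: le_trans bP _.
  by rewrite [X in _ <= X]exprMn [K ^+ 2]expr2 -mulrA ler_wpM2l // ltW.
exists (x', z), (f + m%:C *: u, - bs x' + z'); split.
- exists (f - h + m%:C *: u), (bs x'), h, z'; split=> //=; first exact: bsP.
  by rewrite addrAC subrK.
- rewrite nrm_pair /= gt_max nrm_distC; apply/andP; split.
    apply: le_lt_trans u_le _; apply: eta_d.
    by rewrite /k mulrDl; lra.
  by apply: lt_trans yz _; rewrite -[eta]mul1r; apply: eta_d; rewrite /k mulrDl; lra.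
- rewrite nrm_pair /= gt_max; apply/andP; split.
    have -> : f - (f + m%:C *: u) = - (m%:C *: u) by rewrite opprD addrA subrr add0r.
    rewrite nrmN nrmZ; apply: (@le_lt_trans _ _ (`|m| * K * eta)).
      by rewrite -mulrA ler_wpM2l.
    by apply: eta_d; rewrite /k mulrDl; lra.
  have -> : - bs x + y' - (- bs x' + z') = bs u + (y' - z').
    by rewrite bs_sub // opprD opprK addrACA [- bs x + _]addrC.
  apply: le_lt_trans (nrmD _ _) _.
  apply: (@le_lt_trans _ _ ((K + 1) * eta)).
    by rewrite mulrDl mul1r; apply: lerD => //; apply: ltW.
  by apply: eta_d; rewrite /k mulrDl; lra.
Qed.

(** The second row gives y = Q (h + B^* x) with Q = (D - g)^-1; inserted into the first, it leaves
    s(x,z) = <f,z> - <Q h, B^* z>, an equation for [x] alone. *)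
Lemma weak_solution f h : exists x y, [/\ F x, D (y, h + bs x + g%:C *: y)
  & forall z, F z -> ra x z + rip y (bs z) = rip (f + g%:C *: x) z].
Proof.
have [D_bij _] := D_res.
have /choice[Q QP] : forall v, exists u, D (u, v + g%:C *: u).
  by move=> v; have [u [Du _]] := D_bij v; exists u.
have Q_eq v u : D (u, v + g%:C *: u) -> Q v = u.
  by move=> Du; have [u0 [_ uu]] := D_bij v; rewrite -(uu _ Du) -(uu _ (QP v)).
have Q_lin (r : R) v w : Q (r%:C *: v + w) = r%:C *: Q v + Q w.
  apply: Q_eq; have := op_lin r%:C D_op (QP v) (QP w).
  by rewrite !scalerDr !scalerA [g%:C * _]mulrC addrACA.
have Q_sym v w : rip (Q v) w = rip (Q w) v.
  have := self_adjoint_rip D_sa (QP v) (QP w).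
  by rewrite ripDl ripDr ripZl ripZr (ripC v) => /addIr ->.
pose t := g - dl; have t0 : 0 < t by rewrite /t; move: e_lt b_ge0 e_gt0; lra.
have Q_neg v : t * nrm (Q v) ^+ 2 <= - rip (Q v) v.
  have := D_le (QP v); rewrite ripDl ripZl -nrm_sqr (ripC v) /t; lra.
have Q_le0 v : rip (Q v) v <= 0.
  have := Q_neg v; have : 0 <= t * nrm (Q v) ^+ 2 by rewrite mulr_ge0 ?sqr_ge0 // ltW.
  lra.
(* Expanding |t Q v + v|^2 >= 0 and using [Q_neg] for the quadratic term leaves t <Q v, v> + |v|^2
   >= 0. *)
have Q_ge v : - (nrm v ^+ 2 / t) <= rip (Q v) v.
  have := rip_ge0 (t%:C *: Q v + v).
  rewrite ripDl !ripDr !ripZl !ripZr -!nrm_sqr (ripC v) => h1.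
  have h2 := Q_neg v.
  have h3 : t * (t * nrm (Q v) ^+ 2) <= t * - rip (Q v) v by rewrite ler_pM2l.
  rewrite lerNl ler_pdivlMr // mulNr mulrC; lra.
pose s x z := ra x z + (- g * rip x z + rip (Q (bs x)) (bs z)).
have sf : real_form F s.
  have [F0 FD ql qs] := qa_real.
  split=> // [r x y z Fx Fy Fz|x y Fx Fy]; rewrite /s.
    by rewrite ql // bs_lin // Q_lin !ripDl !ripZl; ring.
  by rewrite qs // ripC Q_sym.
have s_ge x : F x -> e * nrm x ^+ 2 <= s x x.
  move=> Fx; rewrite /s -nrm_sqr; have h1 := Q_ge (bs x).
  have h2 := bs_gap Fx; set X := ra x x - (g + e) * nrm x ^+ 2 in h2.
  have h3 : nrm (bs x) ^+ 2 / t <= X.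
    have te : 0 < t - e by rewrite /t; move: e_lt b_ge0; lra.
    have X0 : 0 <= X by rewrite -(pmulr_rge0 _ te); apply: le_trans (sqr_ge0 _) h2.
    rewrite ler_pdivrMr //; apply: le_trans h2 _; rewrite mulrC -/t.
    by rewrite ler_wpM2l // gerBl ltW.
  by move: h3; rewrite /X; lra.
have s0 x : F x -> 0 <= s x x.
  by move=> /s_ge; apply: le_trans; rewrite mulr_ge0 ?sqr_ge0 // ltW.
have s_bd (c : R) x : F x -> c * nrm x ^+ 2 <= `|c| / e * s x x.
  move=> Fx; apply: (@le_trans _ _ (`|c| * nrm x ^+ 2)).
    by rewrite ler_wpM2r ?sqr_ge0 // ler_norm.
  by rewrite -mulrA ler_wpM2l // ler_pdivlMl // s_ge.
have tb : 0 < t - b by rewrite /t; move: e_lt e_gt0; lra.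
(* From [Q_ge] and [bs_bound], (t - b) qa[x] <= t s[x] + (g t + a) |x|^2, and [s_ge] controls the
   last term. *)
pose K1 := (t + `|g * t + a| / e) / (t - b).
have ra_s x : F x -> ra x x <= K1 * s x x.
  move=> Fx; rewrite /K1 mulrAC ler_pdivlMr // mulrDl.
  apply: le_trans (lerD (lexx _) (s_bd (g * t + a) x Fx)).
  have h1 := Q_ge (bs x); have h2 := bs_bound Fx.
  have h3 : t * - (nrm (bs x) ^+ 2 / t) <= t * rip (Q (bs x)) (bs x).
    by rewrite ler_pM2l.
  have h4 : t * - (nrm (bs x) ^+ 2 / t) = - nrm (bs x) ^+ 2.
    by field; rewrite gt_eqF.
  by rewrite h4 in h3; rewrite /s -nrm_sqr; lra.
have K1_ge0 : 0 <= K1.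
  by rewrite /K1 divr_ge0 ?(ltW tb) // addr_ge0 ?(ltW t0) // divr_ge0 // ltW.
pose K2 := K1 + `|al| / e.
have K2_ge0 : 0 <= K2 by rewrite addr_ge0 // divr_ge0 // ltW.
have nra_s x : F x -> `|ra x x| <= K2 * s x x.
  move=> Fx; rewrite ler_norml /K2 mulrDl.
  have h1 := ra_s _ Fx; have h2 := s_bd (- al) _ Fx; rewrite normrN in h2.
  have h3 := qa_ge Fx; have h4 := s0 _ Fx.
  have h5 : 0 <= K1 * s x x by rewrite mulr_ge0.
  have h6 : 0 <= `|al| / e * s x x by rewrite mulr_ge0 // divr_ge0 // ltW.
  apply/andP; split; lra.
have s_le x : F x -> s x x <= ra x x + - g * nrm x ^+ 2.
  by move=> Fx; rewrite /s -nrm_sqr addrA gerDl.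
pose K3 := K2 + `|g| + 1.
have sc : form_complete F s.
  have [_ _ qa_closed _ _] := qa_form.
  apply: (@closed_qform_complete _ _ qa s e K3) => //.
  - exact: qa_sym.
  - by rewrite ltr_wpDl // addr_ge0.
  - move=> x Fx; apply: le_trans (nra_s _ Fx) _; rewrite ler_wpM2r ?s0 //.
    by rewrite /K3 -addrA lerDl addr_ge0.
  - move=> x Fx; apply: le_trans (s_le _ Fx) _; rewrite mulrDr; apply: lerD.
      apply: le_trans (ler_norm _) _; rewrite ler_peMl //.
      by rewrite lerDr addr_ge0.
    rewrite ler_wpM2r ?sqr_ge0 //; apply: le_trans (ler_norm _) _; rewrite normrN.
    by rewrite /K3; move: K2_ge0; lra.
pose l z := rip f z - rip (Q h) (bs z).
pose K4 := `|a| / e + b * K2.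
have K4_ge0 : 0 <= K4 by rewrite addr_ge0 ?divr_ge0 ?mulr_ge0 // ltW.
have bs_s x : F x -> nrm (bs x) ^+ 2 <= K4 * s x x.
  move=> Fx; apply: le_trans (bs_bound Fx) _; rewrite mulrDl; apply: lerD.
    exact: s_bd.
  rewrite -mulrA ler_wpM2l //; apply: le_trans (nra_s _ Fx); exact: ler_norm.
have [x Fx xl] : exists2 x, F x & forall z, F z -> s x z = l z.
  apply: (@real_form_riesz _ _ _ _ _
    (2 * (nrm f ^+ 2 / e + nrm (Q h) ^+ 2 * K4)) sf s0 sc) => //.
  - by move=> r x y Fx Fy; rewrite /l bs_lin // !ripDr !ripZr; ring.
  - move=> x Fx; rewrite /l.
    have h1 := rip_CS f x; have h2 := rip_CS (Q h) (bs x).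
    have h3 : nrm f ^+ 2 * nrm x ^+ 2 <= nrm f ^+ 2 / e * s x x.
      by rewrite -mulrA ler_wpM2l ?sqr_ge0 // ler_pdivlMl // s_ge.
    have h4 : nrm (Q h) ^+ 2 * nrm (bs x) ^+ 2 <= nrm (Q h) ^+ 2 * K4 * s x x.
      by rewrite -mulrA ler_wpM2l ?sqr_ge0 // bs_s.
    have {h1 h3} h5 := le_trans h1 h3; have {h2 h4} h6 := le_trans h2 h4.
    have := sqr_ge0 (rip f x + rip (Q h) (bs x)).
    rewrite -(mulrA 2) (mulrDl (_ / e)).
    move: (_ / e * _) (_ * K4 * _) h5 h6 => X Y h5 h6; nra.
  - apply: mulr_ge0 => //; apply: addr_ge0; last by rewrite mulr_ge0 ?sqr_ge0.
    by rewrite divr_ge0 ?sqr_ge0 // ltW.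
exists x, (Q (h + bs x)); split=> // z Fz.
have QD : Q (h + bs x) = Q h + Q (bs x).
  by have := Q_lin 1 h (bs x); rewrite !scale1r.
have := xl _ Fz; rewrite /s /l QD !ripDl ripZl; lra.
Qed.

Lemma block_krein_resolvent :
  krein_nonnegative (op_shift (closure M0) g%:C) /\
  resolvent_set (closure M0) g%:C.
Proof.
split; first exact: block_krein_nonneg.
split=> [[f h]|]; last first.
  by exists (2 / e) => u v /block_bound; rewrite !normE -rmorphM lecR.
have [x [y [Fx Dy wx]]] := weak_solution f h.
have Muv : op_shift (closure M0) g%:C ((x, y), (f, h)).
  have := weak_solution_closure Fx Dy wx.
  by rewrite (addrAC h) [- bs x + _]addrC addrK.
by exists (x, y); split=> // u' Mu'; exact: block_unique Muv Mu'.
Qed.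

End Block.

(** * From the hypotheses on A, B and D to the block estimates *)

Theorem proposition7p2 (R : realType) (H1 H2 : hilbertType R)
    (A : set (H1 * H1)) (B : set (H2 * H1)) (D : set (H2 * H2))
    (qa : qform H1) (qd : qform H2) (a b alpha delta : R)
    (H1_nonzero : exists x : H1, x != 0)
    (H2_nonzero : exists y : H2, y != 0)
    (A_sa : self_adjoint A) (A_below : bounded_from_below A)
    (B_op : is_operator B) (B_dense : densely_defined B)
    (B_closable : closable B)
    (D_sa : self_adjoint D) (D_above : bounded_from_above D)
    (qa_form : is_form_of A qa) (qd_form : is_form_of D qd)
    (qa_domB : form_dom qa `<=` dom (adjoint B))
    (BD : (dom B `<=` dom D /\ is_core D (dom B)) \/ form_dom qd `<=` dom B)
    (b_ge0 : 0 <= b)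
    (B_bound : forall x y, form_dom qa x -> adjoint B (x, y) ->
       `|y| ^+ 2 <= a%:C * `|x| ^+ 2 + b%:C * qa x x)
    (alpha_min : is_min_spectrum A alpha)
    (delta_max : is_max_spectrum D delta)
    (gap : b * delta + b ^+ 2 + a < 0 \/
       b + Num.sqrt (pos_part (b * delta + b ^+ 2 + a)) < (alpha - delta) / 2) :
  let M := closure (block_op A B D) in
  forall gamma : R, mu a b delta < gamma < mu_plus a b alpha delta ->
    krein_nonnegative (op_shift M gamma%:C) /\ resolvent_set M gamma%:C.
Proof.
move=> M g g_mu.
have [qs _ _ _ Aq] := qa_form.
have qa_ge := form_ge_min_spectrum A_sa A_below qa_form alpha_min.
have D_le := le_max_spectrum D_sa D_above delta_max.
have bs_bound x : form_dom qa x ->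
    nrm (opv (adjoint B) x) ^+ 2 <= a * nrm x ^+ 2 + b * Re (qa x x).
  move=> Fx; have := B_bound _ _ Fx (opvP (qa_domB _ Fx)).
  rewrite (qform_diagE qs Fx) !normE -!rmorphXn -!rmorphM -rmorphD /=.
  by rewrite lecR.
(* This excludes the case where neither (A1) nor (A2) holds; a nonzero vector of [dom A] exists
   because [H1] is nonzero. *)
have a_ge0 : b = 0 -> 0 <= a.
  move=> b0; have [x [Ax x0]] : exists x, dom A x /\ x != 0.
    apply: contrapT => nA; have [x0] := H1_nonzero; apply/negP; rewrite negbK.
    apply/eqP; have [_ dA _] := A_sa; apply: (dense_rip_eq0 dA) => y Ay.
    have [->|yn] := eqVneq y 0; first exact: rip0l.
    by case: nA; exists y.
  have [x' /Aq[Fx _]] := Ax.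
  have nx : 0 < nrm x ^+ 2.
    rewrite exprn_gt0 // lt_def nrm_ge0 andbT.
    by apply: contra_neq x0; apply: nrm_eq0.
  have := le_trans (sqr_ge0 _) (bs_bound _ Fx).
  by rewrite b0 mul0r addr0 pmulr_lge0.
have [bg alt] := gap_alternative b_ge0 a_ge0 gap g_mu.
have [lam lam_gap lam_le] : exists2 lam, a + g * (g - delta) < lam * (g - delta - b)
    & forall x, form_dom qa x -> lam * nrm x ^+ 2 <= Re (qa x x).
  case: alt => [[b_gt0 h]|h]; last by exists alpha.
  exists (- a / b) => // x Fx; have bs_ge0 := le_trans (sqr_ge0 _) (bs_bound _ Fx).
  by rewrite mulrAC ler_pdivrMr // mulNr; lra.
have [e /andP[e_gt0 e_lt] e_gap] := gap_constant bg lam_gap.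
apply: (@block_krein_resolvent _ _ _ _ _ _ qa a b alpha delta g e) => //.
(* Collecting the terms in qa[x], the claim becomes (a + (g+e)(g-delta-e)) |x|^2 <= (g-delta-e-b)
   qa[x], which is [e_gap] combined with the lower bound [lam]. *)
- move=> x Fx; apply: le_trans (bs_bound _ Fx) _.
  have h1 : (g - delta - e - b) * (lam * nrm x ^+ 2) <= (g - delta - e - b) * Re (qa x x).
    by apply: ler_wpM2l; [lra | apply: lam_le].
  have h2 : (a + (g + e) * (g - delta - e)) * nrm x ^+ 2 <=
      lam * (g - delta - e - b) * nrm x ^+ 2 by rewrite ler_wpM2r ?sqr_ge0.
  lra.
- by apply: resolvent_below_min alpha_min _; rewrite gtrBl.
- by apply: resolvent_above_max delta_max _; lra.
(* In case (I) the core property supplies the approximants; in case (II) dom D lies in the form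
   domain, hence in dom B, and [y] approximates itself. *)
- move=> y y' Dy d d0; case: BD => [[_ [_ Dcl]]|qd_domB].
    have /closure_nrmP/(_ _ d0)[z [z' [[Dz Bz] yz yz']]] :
      closure (op_restrict D (dom B)) (y, y').
      by rewrite Dcl; exact: subset_closure.
    by exists z, z'.
  have [_ _ _ _ Dq] := qd_form; exists y, y'; split=> //; rewrite ?subrr ?nrm0 //.
  by apply: qd_domB; have /Dq[] := Dy.
Qed.
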